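(* Let $d\ge2$, let $A$ be a nonempty compact subset of $\mathbb{R}^d$, $r>0$ and $rA:=\{rx:x\in A\}$. Then, for each $i\in\{0,\ldots,d-1\}$, $$\overline{\mathfrak m}_i(rA)=\overline{\mathfrak m}_i(A)\quad\text{and}\quad\underline{\mathfrak m}_i(rA)=\underline{\mathfrak m}_i(A).$$ Furthermore, for any $q\in\mathbb{R}$, $$\overline{\mathcal M}_i^q(rA)=r^q\,\overline{\mathcal M}_i^q(A)\quad\text{and}\quad\underline{\mathcal M}_i^q(rA)=r^q\,\underline{\mathcal M}_i^q(A).$$ Moreover, the same relations hold for the total variation counterparts: $$\overline{\mathcal M}_i^{\mathrm{var},q}(rA)=r^q\,\overline{\mathcal M}_i^{\mathrm{var},q}(A)\quad\text{and}\quad\underline{\mathcal M}_i^{\mathrm{var},q}(rA)=r^q\,\underline{\mathcal M}_i^{\mathrm{var},q}(A).$$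
   Context: Notation: $\mathbb{S}^{d-1}$ is the unit sphere, $\kappa_k=\pi^{k/2}/\Gamma(k/2+1)$, $\omega_k=k\kappa_k$. For a nonempty closed set $A\subset\mathbb{R}^d$, $\mathrm{Unp}(A)$ is the set of $y\in\mathbb{R}^d\setminus A$ having a unique nearest point $\pi_A(y)$ in $A$. The generalized normal bundle is $N(A)=\{(\pi_A(y),\frac{y-\pi_A(y)}{\mathrm{dist}(y,A)}):y\in \mathrm{Unp}(A)\}$. The local reach of $A$ at $(x,u)\in N(A)$ is $\delta(A,x,u)=\sup\{t\ge 0:\pi_A(x+tu)=x\}\in(0,\infty]$. Support measures (Hug, Last, Weil): for every nonempty closed $A\subset\mathbb{R}^d$ there are signed measures $\mu_0(A;\cdot),\ldots,\mu_{d-1}(A;\cdot)$ concentrated on $N(A)$ (each a difference $\mu_i^+-\mu_i^-$ of mutually singular $\sigma$-finite Borel measures on $\mathbb{R}^d\times\mathbb{S}^{d-1}$ vanishing outside $N(A)$; $|\mu_i|=\mu_i^++\mu_i^-$ is the total variation measure) such that $\int_{N(A)}\mathbf 1\{x\in B\}\min\{r,\delta(A,x,u)\}^{d-i}\,|\mu_i|(A;d(x,u))<\infty$ for all compact $B\subset\mathbb{R}^d$, $r>0$, and, for every bounded measurable $f:\mathbb{R}^d\to\mathbb{R}$ with compact support, $$\int_{\mathbb{R}^d\setminus A}f(x)\,dx=\sum_{i=0}^{d-1}\omega_{d-i}\int_0^\infty\int_{N(A)}t^{d-i-1}\mathbf 1\{t<\delta(A,x,u)\}f(x+tu)\,\mu_i(A;d(x,u))\,dt.$$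 These properties determine the measures; they are called the support measures of $A$. For $A$ compact and $t>0$: $\beta_i(A;t)=\int_{N(A)}\mathbf 1\{t<\delta(A,x,u)\}\,\mu_i(A;d(x,u))$ and $\beta_i^{\mathrm{var}}(A;t)=\int_{N(A)}\mathbf 1\{t<\delta(A,x,u)\}\,|\mu_i|(A;d(x,u))$ (both finite). For $q\in\mathbb{R}$: $\overline{\mathcal M}_i^{q}(A)=\limsup_{t\to0^+}t^{q-i}\beta_i(A;t)$, $\overline{\mathcal M}_i^{\mathrm{var},q}(A)=\limsup_{t\to0^+}t^{q-i}\beta_i^{\mathrm{var}}(A;t)$, and $\underline{\mathcal M}_i^{q}(A)$, $\underline{\mathcal M}_i^{\mathrm{var},q}(A)$ are the corresponding lower limits (values in $[-\infty,\infty]$). The basic scaling exponents are $\overline{\mathfrak m}_i(A)=\inf\{q\in\mathbb{R}:\overline{\mathcal M}_i^{\mathrm{var},q}(A)=0\}$ and $\underline{\mathfrak m}_i(A)=\inf\{q\in\mathbb{R}:\underline{\mathcal M}_i^{\mathrm{var},q}(A)=0\}$ (both $-\infty$ if $\mu_i(A;\cdot)\equiv 0$). *)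

(* Defs.v *)
From HB Require Import structures.
From mathcomp Require Import all_boot all_order all_algebra.
From mathcomp Require Import all_classical all_reals all_analysis.

Set Implicit Arguments.
Unset Strict Implicit.
Unset Printing Implicit Defensive.

Import Order.TTheory GRing.Theory Num.Theory.
Import numFieldNormedType.Exports.

Local Open Scope classical_set_scope.
Local Open Scope ring_scope.

Section borel_rV.
Context {R : realType} {n : nat}.

Definition rV_borel : set (set 'rV[R]_n) := <<s @open 'rV[R]_n >>.

Let rV_borel0 : rV_borel set0. Proof. exact: sigma_algebra0. Qed.

Let rV_borelC (A : set 'rV[R]_n) : rV_borel A -> rV_borel (~` A).
Proof. exact: sigma_algebraC. Qed.

Let rV_borel_bigcup (F : (set 'rV[R]_n)^nat) :
  (forall i, rV_borel (F i)) -> rV_borel (\bigcup_i F i).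
Proof. exact: sigma_algebra_bigcup. Qed.

HB.instance Definition _ := @isMeasurable.Build
  (sigma_display (@open 'rV[R]_n)) 'rV[R]_n
  rV_borel rV_borel0 rV_borelC rV_borel_bigcup.

End borel_rV.

Section lebesgue_tuple.
Context {R : realType}.
Local Notation mR := (measurableTypeR R).
Local Open Scope ereal_scope.

Definition tuple_cons n (p : mR * n.-tuple mR) : n.+1.-tuple mR :=
  [the n.+1.-tuple mR of p.1 :: p.2].

Lemma measurable_tuple_cons n : measurable_fun setT (@tuple_cons n).
Proof. exact: measurable_cons. Qed.

Section lebesgue_step.
Context {n : nat} (m : {sigma_finite_measure set (n.-tuple mR) -> \bar R}).

Definition lebesgue_step : set (n.+1.-tuple mR) -> \bar R :=
  pushforward (lebesgue_measure \x m) (@tuple_cons n).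

Let pm := measure_function_pushforward__canonical__measure_function_Measure
  (lebesgue_measure \x m) (@measurable_tuple_cons n).

Let lebesgue_step0 : lebesgue_step set0 = 0.
Proof. exact: (measure0 pm). Qed.

Let lebesgue_step_ge0 A : 0 <= lebesgue_step A.
Proof. exact: (measure_ge0 pm). Qed.

Let lebesgue_step_sigma_additive : semi_sigma_additive lebesgue_step.
Proof. exact: (@measure_semi_sigma_additive _ _ _ pm). Qed.

HB.instance Definition _ := isMeasure.Build _ _ _ lebesgue_step
  lebesgue_step0 lebesgue_step_ge0 lebesgue_step_sigma_additive.

Let lebesgue_step_sigma_finite : sigma_finite setT lebesgue_step.
Proof.
have /sigma_finiteP[G [UG ndG mG]] := sigma_finiteT (@lebesgue_measure R).
have /sigma_finiteP[H [UH ndH mH]] := sigma_finiteT m.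
pose F k := G k `*` H k.
have UF : setT = \bigcup_k F k.
  apply/seteqP; split=> // -[x t] _.
  have [a _ Gx] : (\bigcup_k G k) x by rewrite -UG.
  have [b _ Ht] : (\bigcup_k H k) t by rewrite -UH.
  exists (maxn a b) => //; split => /=.
    by move: x Gx; exact/subsetPset/ndG/leq_maxl.
  by move: t Ht; exact/subsetPset/ndH/leq_maxr.
have mF k : measurable (F k) /\ (lebesgue_measure \x m) (F k) < +oo.
  have [mGk Gk] := mG k; have [mHk Hk] := mH k.
  split; first exact: measurableX.
  by rewrite product_measure1E// lte_mul_pinfty// ge0_fin_numE.
pose g (t : n.+1.-tuple mR) : mR * n.-tuple mR :=
  (tnth t ord0, [tuple of behead t]).
have mg : measurable_fun setT g.
  by apply: measurable_fun_pair; [exact: measurable_tnth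
                                 |exact: measurable_behead].
have gK : cancel (@tuple_cons n) g.
  by case=> x t; rewrite /g /tuple_cons /=; congr pair; apply: val_inj.
exists (fun k => g @^-1` F k).
  by rewrite -preimage_bigcup -UF preimage_setT.
move=> k; have [mFk Fk] := mF k; split.
  by rewrite -[X in measurable X]setTI; exact: mg.
rewrite /lebesgue_step /pushforward -comp_preimage.
by rewrite (_ : g \o _ = id) //; apply/funext => x /=; rewrite gK.
Qed.

HB.instance Definition _ := Measure_isSigmaFinite.Build _ _ _ lebesgue_step
  lebesgue_step_sigma_finite.

End lebesgue_step.

Fixpoint lebesgue_tuple n : {sigma_finite_measure set (n.-tuple mR) -> \bar R} :=
  if n is n'.+1 then lebesgue_step (lebesgue_tuple n')
  else \d_([tuple] : 0.-tuple mR).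

Definition rV_of_tuple n (t : n.-tuple mR) : 'rV[R]_n := \row_i tnth t i.

Let rational_box n (p : 'rV[rat]_n * 'rV[rat]_n) : set 'rV[R]_n :=
  [set x | forall i, (ratr (p.1 ord0 i) < x ord0 i < ratr (p.2 ord0 i))%R].

Lemma measurable_rV_of_tuple n : measurable_fun setT (@rV_of_tuple n).
Proof.
apply: (@measurability _ _ _ _ setT _ (@open 'rV[R]_n)) => //.
move=> _ [U oU <-]; rewrite setTI.
pose F (k : nat) : set 'rV[R]_n := if unpickle k is Some p then
  [set x | rational_box p x /\ (rational_box p `<=` U)] else set0.
have -> : U = \bigcup_k F k.
  apply/seteqP; split=> [x Ux|x [k _]]; last first.
    by rewrite /F; case: unpickle => // p [px]; exact.
  have /nbhs_ballP[e /= e0 eU] : nbhs x U by exact: open_nbhs_nbhs.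
  have lo i : exists q : rat, ((x ord0 i - e)%R < ratr q < x ord0 i)%R.
    have [|q] := @rat_in_itvoo R (x ord0 i - e)%R (x ord0 i).
      by rewrite ltrBlDr ltrDl.
    by rewrite in_itv /=; exists q.
  have hi i : exists q : rat, (x ord0 i < ratr q < (x ord0 i + e)%R)%R.
    have [|q] := @rat_in_itvoo R (x ord0 i) (x ord0 i + e)%R.
      by rewrite ltrDl.
    by rewrite in_itv /=; exists q.
  have [a aP] := choice lo; have [b bP] := choice hi.
  pose p := (\row_i a i, \row_i b i) : 'rV[rat]_n * 'rV[rat]_n.
  exists (pickle p) => //; rewrite /F pickleK; split.
    move=> i; rewrite !mxE.
    by have /andP[_ ->] := aP i; have /andP[-> _] := bP i.
  move=> y /= py; apply: eU; split=> // i j; rewrite ord1; move: (py j).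
  rewrite !mxE /= => /andP[ay yb]; rewrite /ball /= ltr_distlC.
  have /andP[ea _] := aP j; have /andP[_ be] := bP j.
  by rewrite (lt_trans ea ay) (lt_trans yb be).
rewrite preimage_bigcup; apply: bigcup_measurable => k _; rewrite /F.
case: unpickle => [p|]; last by rewrite preimage_set0.
have [pU|pU] := pselect (rational_box p `<=` U); last first.
  by rewrite (_ : _ @^-1` _ = set0) // -subset0 => t [].
rewrite (_ : _ @^-1` _ = \bigcap_(i in [set: 'I_n])
    ((fun t : n.-tuple mR => tnth t i) @^-1`
      `]ratr (p.1 ord0 i), ratr (p.2 ord0 i)[)).
  apply: fin_bigcap_measurable => // i _; rewrite -[X in measurable X]setTI.
  by apply: measurable_tnth => //; exact: measurable_itv.
apply/seteqP; split=> [t [pt _] i _ /=|t pt].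
  by have := pt i; rewrite mxE in_itv.
by split=> // i; have := pt i Logic.I; rewrite /= mxE in_itv.
Qed.

Definition lebesgue_rV n : set 'rV[R]_n -> \bar R :=
  pushforward (lebesgue_tuple n) (@rV_of_tuple n).

Section lebesgue_rV_measure.
Context {n : nat}.

Let pm := measure_function_pushforward__canonical__measure_function_Measure
  (lebesgue_tuple n) (@measurable_rV_of_tuple n).

Let lebesgue_rV0 : @lebesgue_rV n set0 = 0.
Proof. exact: (measure0 pm). Qed.

Let lebesgue_rV_ge0 A : 0 <= @lebesgue_rV n A.
Proof. exact: (measure_ge0 pm). Qed.

Let lebesgue_rV_sigma_additive : semi_sigma_additive (@lebesgue_rV n).
Proof. exact: (@measure_semi_sigma_additive _ _ _ pm). Qed.

HB.instance Definition _ := isMeasure.Build _ _ _ (@lebesgue_rV n)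
  lebesgue_rV0 lebesgue_rV_ge0 lebesgue_rV_sigma_additive.

End lebesgue_rV_measure.
End lebesgue_tuple.
Arguments lebesgue_rV {R n}.

Lemma lebesgue_tuple_box (R : realType) n (a b : 'I_n -> R) :
  (forall i, a i <= b i) ->
  let B := [set t : n.-tuple (measurableTypeR R) |
              forall i, a i < tnth t i <= b i] in
  measurable B /\ lebesgue_tuple n B = (\prod_(i < n) (b i - a i))%:E.
Proof.
elim: n a b => [|n IH] a b ab /=.
  rewrite big_ord0 (_ : [set _ | _] = setT).
    by rewrite diracT; split=> //; exact: measurableT.
  by apply/seteqP; split=> // t _ [].
have [mB EB] := IH (fun i => a (lift ord0 i)) (fun i => b (lift ord0 i))
                   (fun i => ab _).
split.
  rewrite (_ : [set _ | _] = \bigcap_(i in [set: 'I_n.+1])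
    ((fun t : n.+1.-tuple (measurableTypeR R) => tnth t i) @^-1` `]a i, b i])).
    apply: fin_bigcap_measurable => // i _; rewrite -[X in measurable X]setTI.
    by apply: measurable_tnth => //; exact: measurable_itv.
  apply/seteqP; split=> t /= h i; first by move=> _; move: (h i); rewrite /= in_itv.
  by have := h i Logic.I; rewrite /= in_itv.
rewrite /lebesgue_step /pushforward.
rewrite (_ : _ @^-1` _ = `]a ord0, b ord0] `*`
    [set t : n.-tuple (measurableTypeR R) |
      forall i, a (lift ord0 i) < tnth t i <= b (lift ord0 i)]); last first.
  apply/seteqP; split=> -[x t] /=.
    move=> h; split; first by move: (h ord0); rewrite /= in_itv.
    by move=> i; have := h (lift ord0 i); rewrite tnthS.
  move=> [h0 h] i; case: (unliftP ord0 i) => [j ->|->].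
    by rewrite tnthS; exact: h.
  by move: h0; rewrite /= in_itv.
rewrite product_measure1E //= EB lebesgue_measure_itv /= lte_fin big_ord_recl.
case: ltP => h; first by [].
by rewrite mul0e (le_anti (introT andP (conj h (ab ord0)))) subrr mul0r.
Qed.

Lemma lebesgue_rV_box (R : realType) n (a b : 'rV[R]_n) :
  (forall i, a ord0 i <= b ord0 i) ->
  lebesgue_rV [set x : 'rV[R]_n | forall i, a ord0 i < x ord0 i <= b ord0 i] =
  (\prod_(i < n) (b ord0 i - a ord0 i))%:E.
Proof.
move=> ab; have [_ <-] := @lebesgue_tuple_box R n _ _ ab.
rewrite /lebesgue_rV /pushforward; congr (lebesgue_tuple n _).
by apply/seteqP; split=> t /= h i; have := h i; rewrite mxE.
Qed.

Section euclidean.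
Context {R : realType} {d : nat}.
Implicit Types (A : set 'rV[R]_d) (x y u : 'rV[R]_d).

(* The library's norm on 'rV is the sup norm. *)
Definition enorm x : R := Num.sqrt (\sum_(i < d) x ord0 i ^+ 2).

Definition edist y A : R := inf [set enorm (y - a) | a in A].

(* [nearest_points A y = [set x]] says that y has a unique nearest point in A
   and that it is x, that is, "pi_A(y) is defined and equals x". *)
Definition nearest_points A y : set 'rV[R]_d :=
  [set x | A x /\ enorm (y - x) = edist y A].

Definition Unp A : set 'rV[R]_d :=
  [set y | ~ A y /\ exists x, nearest_points A y = [set x]].

Definition normal_bundle A : set ('rV[R]_d * 'rV[R]_d) :=
  [set p | exists y, [/\ Unp A y, nearest_points A y = [set p.1]
                       & p.2 = (edist y A)^-1 *: (y - p.1)]].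

Definition local_reach A x u : \bar R :=
  ereal_sup [set t%:E | t in
    [set t : R | 0 <= t /\ nearest_points A (x + t *: u) = [set x]]].

End euclidean.

Section signed_measures.
Context {R : realType}.

(* A difference mu^+ - mu^- of mutually singular sigma-finite measures. The
   library's charges are finite, hence not general enough here. *)
Record signed_measure d (T : measurableType d) := SignedMeasure {
  pos_part : {sigma_finite_measure set T -> \bar R} ;
  neg_part : {sigma_finite_measure set T -> \bar R} ;
  mutually_singular : exists S : set T,
    [/\ measurable S, pos_part (~` S) = 0%E & neg_part S = 0%E] }.

Context {d} {T : measurableType d} (mu : signed_measure T).

Definition total_variation : {measure set T -> \bar R} :=
  measure_add (pos_part mu) (neg_part mu).

Definition signed_integral (D : set T) (f : T -> \bar R) : \bar R :=
  (\int[pos_part mu]_(x in D) f x - \int[neg_part mu]_(x in D) f x)%E.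

End signed_measures.
Arguments signed_measure R {d} T.

Section constants.
Context {R : realType}.

Definition Gamma (x : R) : R :=
  \int[lebesgue_measure]_(t in `]0, +oo[) (t `^ (x - 1) * expR (- t)).

(* Volume of the unit ball and surface area of the unit sphere of R^k. *)
Definition kappa (k : nat) : R := pi `^ (k%:R / 2) / Gamma (k%:R / 2 + 1).
Definition omega (k : nat) : R := k%:R * kappa k.

End constants.

Section support_measures.
Context {R : realType} {d : nat}.
Implicit Types (A B : set 'rV[R]_d) (q r t : R).

(* Measures on R^d x S^(d-1) vanishing outside N(A) are represented by measures
   on R^d x R^d vanishing outside N(A), which is a subset of R^d x S^(d-1). *)
Record is_support_measures A
    (mu : 'I_d -> signed_measure R ('rV[R]_d * 'rV[R]_d)%type) : Prop := {
  support_concentrated : forall i : 'I_d,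
    total_variation (mu i) (~` normal_bundle A) = 0%E ;
  support_integrable : forall (i : 'I_d) B r, compact B -> 0 < r ->
    (\int[total_variation (mu i)]_(p in normal_bundle A)
       ((\1_B p.1)%:E * mine r%:E (local_reach A p.1 p.2) ^+ (d - i))
     < +oo)%E ;
  support_steiner : forall f : 'rV[R]_d -> R,
    measurable_fun setT f -> (exists M : R, forall x, `|f x| <= M) ->
    compact (closure [set x | f x != 0]) ->
    (\int[lebesgue_rV]_(x in ~` A) (f x)%:E =
     \sum_(i < d) (omega (d - i))%:E *
       \int[lebesgue_measure]_(t in `]0%R, +oo[)
         signed_integral (mu i) (normal_bundle A) (fun p =>
           (t ^+ (d - i).-1 * (t%:E < local_reach A p.1 p.2)%E%:R
            * f (p.1 + t *: p.2))%:E))%E }.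

Variables (A : set 'rV[R]_d)
  (mu : 'I_d -> signed_measure R ('rV[R]_d * 'rV[R]_d)%type) (i : 'I_d).

Definition beta t : \bar R :=
  signed_integral (mu i) (normal_bundle A)
    (fun p => ((t%:E < local_reach A p.1 p.2)%E%:R)%:E).

Definition beta_var t : \bar R :=
  \int[total_variation (mu i)]_(p in normal_bundle A)
    ((t%:E < local_reach A p.1 p.2)%E%:R)%:E.

Definition upper_content q : \bar R :=
  limf_esup (fun t => ((t `^ (q - i%:R))%:E * beta t)%E) 0^'+.

Definition lower_content q : \bar R :=
  limf_einf (fun t => ((t `^ (q - i%:R))%:E * beta t)%E) 0^'+.

Definition upper_content_var q : \bar R :=
  limf_esup (fun t => ((t `^ (q - i%:R))%:E * beta_var t)%E) 0^'+.

Definition lower_content_var q : \bar R :=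
  limf_einf (fun t => ((t `^ (q - i%:R))%:E * beta_var t)%E) 0^'+.

Definition upper_exponent : \bar R :=
  ereal_inf [set q%:E | q in [set q : R | upper_content_var q = 0%E]].

Definition lower_exponent : \bar R :=
  ereal_inf [set q%:E | q in [set q : R | lower_content_var q = 0%E]].

End support_measures.

(* Main.v *)
Require Import Defs.
From HB Require Import structures.
From mathcomp Require Import all_boot all_order all_algebra.
From mathcomp Require Import all_classical all_reals all_analysis measurable_realfun.
From mathcomp Require Import ring lra.

Set Implicit Arguments.
Unset Strict Implicit.
Unset Printing Implicit Defensive.

Import Order.TTheory GRing.Theory Num.Theory.
Import numFieldNormedType.Exports.

Local Open Scope classical_set_scope.
Local Open Scope ring_scope.

(** The map (x, u, t) |-> x + t u carries C x [a, b] injectively onto a compact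
set K whenever C is a compact set of pairs (x, u) such that the open ball of
radius s > b centered at x + s u touches A from outside at x.  The Steiner
formula for the indicator function of K expresses the volume of K as
  sum_i omega_(d-i) (b^(d-i) - a^(d-i)) / (d - i) * mu_i(A; C).
The dilation by r multiplies this volume by r^d and turns A, C, a, b into
rA, C' = {(r x, u) : (x, u) in C}, ra, rb; comparing coefficients of powers
of b gives mu_i(rA; C') = r^i mu_i(A; C).  Such sets C determine mu_i on
{delta > t} for every t > 0, and uniqueness of the Jordan decomposition carries
the relation over to the positive and negative parts.  Hence
beta_i(rA; r t) = r^i beta_i(A; t), likewise for the total variation, and the
substitution t -> r t in the upper and lower limits concludes. *)

(* [edist] and [total_variation] are also the names of unrelated library notions. *)
Local Notation edist := Defs.edist.
Local Notation total_variation := Defs.total_variation.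

(** * Balls touching a set *)

Section euclidean_space.
Context {R : realType} {d : nat}.
Implicit Types (A : set 'rV[R]_d) (x y u : 'rV[R]_d).

Definition dot x y : R := \sum_(i < d) x ord0 i * y ord0 i.

Lemma enorm_ge0 x : 0 <= enorm x. Proof. exact: sqrtr_ge0. Qed.

Lemma sqr_enorm x : enorm x ^+ 2 = dot x x.
Proof. by rewrite sqr_sqrtr//; apply: sumr_ge0 => i _; exact: sqr_ge0. Qed.

Lemma enorm_dot x : enorm x = Num.sqrt (dot x x).
Proof. by []. Qed.

Lemma dotC x y : dot x y = dot y x.
Proof. by apply: eq_bigr => i _; rewrite mulrC. Qed.

Lemma dotDl x y z : dot (x + y) z = dot x z + dot y z.
Proof. by rewrite -big_split; apply: eq_bigr => i _; rewrite mxE mulrDl. Qed.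

Lemma dotZl c x y : dot (c *: x) y = c * dot x y.
Proof. by rewrite mulr_sumr; apply: eq_bigr => i _; rewrite mxE mulrA. Qed.

Lemma dotDr x y z : dot z (x + y) = dot z x + dot z y.
Proof. by rewrite dotC dotDl !(dotC z). Qed.

Lemma dotZr c x y : dot y (c *: x) = c * dot y x.
Proof. by rewrite dotC dotZl dotC. Qed.

Lemma dot_eq0 x : dot x x = 0 -> x = 0.
Proof.
move=> /eqP; rewrite psumr_eq0; last by move=> i _; exact: sqr_ge0.
move=> /allP x0; apply/rowP => i; rewrite mxE.
by have /(_ (mem_index_enum _)) := x0 i; rewrite mulf_eq0 orbb => /eqP.
Qed.

Lemma enormZ c x : enorm (c *: x) = `|c| * enorm x.
Proof.
by rewrite enorm_dot dotZl dotZr mulrA sqrtrM ?sqr_ge0// -expr2 sqrtr_sqr.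
Qed.

Lemma enormN x : enorm (- x) = enorm x.
Proof. by rewrite -scaleN1r enormZ normrN1 mul1r. Qed.

(** Cauchy-Schwarz: the squared norm of |x|^2 y - (x.y) x equals |x|^2 (|x|^2 |y|^2 - (x.y)^2). *)
Lemma dot_le x y : dot x y <= enorm x * enorm y.
Proof.
have [x0|x0] := eqVneq (dot x x) 0.
  rewrite (dot_eq0 x0) {1}/dot big1 ?mulr_ge0 ?enorm_ge0// => i _.
  by rewrite mxE mul0r.
have xx : 0 < dot x x by rewrite lt_def x0 -sqr_enorm sqr_ge0.
apply: (le_trans (ler_norm _)).
rewrite -(@ler_pXn2r _ 2) ?nnegrE ?mulr_ge0 ?enorm_ge0//.
rewrite exprMn !sqr_enorm -normrX ger0_norm ?sqr_ge0//.
have : 0 <= dot (dot x x *: y - dot x y *: x) (dot x x *: y - dot x y *: x).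
  by rewrite -sqr_enorm sqr_ge0.
rewrite -scaleNr !(dotDl, dotDr, dotZl, dotZr) (dotC y x) => h.
have : 0 <= dot x x * (dot x x * dot y y - dot x y ^+ 2) by move: h; lra.
by rewrite pmulr_rge0// subr_ge0.
Qed.

Lemma ler_enormD x y : enorm (x + y) <= enorm x + enorm y.
Proof.
rewrite -(@ler_pXn2r _ 2) ?nnegrE ?addr_ge0 ?enorm_ge0//.
rewrite sqrrD !sqr_enorm !(dotDl, dotDr) (dotC y x).
by have := dot_le x y; lra.
Qed.

Lemma enorm_continuous : continuous (@enorm R d).
Proof.
move=> x; apply: (@continuous_comp _ _ _ _ (@Num.sqrt R)).
  apply: (continuous_big (op := +%R)) => [z|i _ z]; first exact: add_continuous.
  exact: (continuous_comp (@coord_continuous R 1 d ord0 i z) (@exprn_continuous R 2 _)).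
exact: sqrt_continuous.
Qed.

Lemma edist_has_inf A y : A !=set0 -> has_inf [set enorm (y - a) | a in A].
Proof.
move=> [a Aa]; split; first by exists (enorm (y - a)), a.
by exists 0 => _ [b _ <-]; exact: enorm_ge0.
Qed.

Lemma edist_le A y a : A a -> edist y A <= enorm (y - a).
Proof.
move=> Aa; apply: ge_inf; last by exists a.
by have [] : has_inf _ := edist_has_inf y (ex_intro _ a Aa).
Qed.

Lemma le_edist A y s : A !=set0 ->
  s <= edist y A <-> forall a, A a -> s <= enorm (y - a).
Proof.
move=> A0; split=> [sd a Aa|sd]; first exact: le_trans sd (edist_le _ Aa).
by apply: lb_le_inf => [|_ [a Aa <-]]; [exact: (edist_has_inf y A0).1|exact: sd].
Qed.

Lemma nearest_pointsE A y x : nearest_points A y x <->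
  A x /\ forall a, A a -> enorm (y - x) <= enorm (y - a).
Proof.
split=> [[Ax xE]|[Ax xmin]]; split=> //; first by move=> a; rewrite xE; exact: edist_le.
apply/eqP; rewrite eq_le edist_le// andbT.
by apply/(le_edist _ _ _).2 => //; exists x.
Qed.

(** By the triangle inequality the distance to a set is 1-Lipschitz. *)
Lemma continuous_edist A : A !=set0 -> continuous (fun y => edist y A).
Proof.
move=> A0 y.
have lip z z' : edist z A - edist z' A <= enorm (z - z').
  rewrite lerBlDr -lerBlDl; apply/(le_edist _ _ A0) => a Aa.
  rewrite lerBlDl; apply: (le_trans (edist_le z Aa)).
  by have := ler_enormD (z - z') (z' - a); rewrite addrA subrK.
apply/(@cvgrPdist_le _ _ _ (nbhs y)) => e e0.
have : \forall z \near y, `|0 - enorm (y - z)| <= e.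
  move: e e0; apply/(@cvgrPdist_le _ _ _ (nbhs y)).
  rewrite -[X in _ --> X](_ : enorm (y - y) = 0).
    have yz : y - z @[z --> y] --> y - y.
      by apply: (@cvgB _ _ _ (nbhs y) _ (cst y) id); [exact: cvg_cst|exact: cvg_id].
    exact: (cvg_comp _ _ yz (@enorm_continuous (y - y))).
  by rewrite subrr -(scale0r 0) enormZ normr0 mul0r.
apply: (@filterS _ (nbhs y)) => z.
rewrite sub0r normrN ger0_norm ?enorm_ge0// => ze.
rewrite ler_norml (le_trans (lip y z) ze) andbT lerNl opprB.
by rewrite (le_trans (lip z y))// -enormN opprB.
Qed.

(* [touching A s] are the pairs [(x, u)] for which the open ball of radius [s]
   centered at [x + s u] touches [A] from outside at [x]. *)
Definition touching A s : set ('rV[R]_d * 'rV[R]_d) :=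
  [set p | [/\ A p.1, enorm p.2 = 1 &
               forall a, A a -> s <= enorm (p.1 + s *: p.2 - a)]].

(* With w = x - a and |u| = 1, the ball condition reads |w|^2 + 2 s w.u >= 0,
   and |w + t u|^2 - t^2 is a convex combination of |w|^2 + 2 s w.u and |w|^2. *)
Lemma touching_sqr A s t x u a : 0 < s -> 0 <= t -> touching A s (x, u) -> A a ->
  t ^+ 2 + (1 - t / s) * dot (x - a) (x - a) <= enorm (x + t *: u - a) ^+ 2.
Proof.
move=> s0 t0 [/= Ax u1 sA] Aa; have := sA _ Aa.
have E c : x + c *: u - a = (x - a) + c *: u by rewrite addrAC.
rewrite -(@ler_pXn2r _ 2) ?nnegrE ?enorm_ge0 ?(ltW s0)// !E !sqr_enorm.
have uu : dot u u = 1 by rewrite -sqr_enorm u1 expr1n.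
move: (x - a) => w; rewrite !(dotDl, dotDr, dotZl, dotZr) uu (dotC u w).
set W := dot w w; set v := dot w u => h.
have h1 : 0 <= t / s * (W + 2 * (s * v)).
  by apply: mulr_ge0; [rewrite divr_ge0// ltW|move: h; lra].
have E2 : t / s * (W + 2 * (s * v)) = t / s * W + 2 * (t * v).
  by field; rewrite gt_eqF.
by move: h1; rewrite E2; lra.
Qed.

(** For t <= s the term (1 - t/s) |x - a|^2 in [touching_sqr] is nonnegative. *)
Lemma touching_le A s t : 0 <= t -> 0 < s -> t <= s -> touching A s `<=` touching A t.
Proof.
move=> t0 s0 ts [x u] txu; have [/= Ax u1 sA] := txu; split=> //= a Aa.
rewrite -(@ler_pXn2r _ 2) ?nnegrE ?enorm_ge0//.
apply: le_trans (touching_sqr s0 t0 txu Aa); rewrite lerDl mulr_ge0//.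
  by rewrite subr_ge0 ler_pdivrMr// mul1r.
by rewrite -sqr_enorm sqr_ge0.
Qed.

(** By [touching_sqr], a point a of A at distance at most t from x + t u satisfies (1 - t/s) |x -
    a|^2 <= 0, and t < s forces a = x. At t = s the nearest point may fail to be unique. *)
Lemma touching_nearest A s t x u : 0 <= t -> t < s -> touching A s (x, u) ->
  nearest_points A (x + t *: u) = [set x] /\ edist (x + t *: u) A = t.
Proof.
move=> t0 ts txu; have s0 := le_lt_trans t0 ts; have [/= Ax u1 sA] := txu.
have tE : enorm (x + t *: u - x) = t.
  by rewrite addrAC subrr add0r enormZ u1 mulr1 ger0_norm.
have xn : nearest_points A (x + t *: u) x.
  apply/nearest_pointsE; split=> // a Aa; rewrite tE.
  by have [/= _ _ ] := touching_le t0 s0 (ltW ts) txu; exact.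
split; last by case: xn => _; rewrite tE.
apply/seteqP; split=> [a /nearest_pointsE[Aa amin]/=|_ ->//].
have := touching_sqr s0 t0 txu Aa.
have : enorm (x + t *: u - a) ^+ 2 <= t ^+ 2.
  by rewrite -[in leRHS]tE ler_pXn2r ?nnegrE ?enorm_ge0//; exact: amin.
move=> h1 h2; have : (1 - t / s) * dot (x - a) (x - a) <= 0 by lra.
rewrite pmulr_rle0 ?subr_gt0 ?ltr_pdivrMr ?mul1r// => h.
apply/esym/eqP; rewrite -subr_eq0; apply/eqP/dot_eq0/le_anti.
by rewrite h -sqr_enorm sqr_ge0.
Qed.

Lemma nearest_touching A x u t : 0 <= t -> enorm u = 1 ->
  nearest_points A (x + t *: u) x -> touching A t (x, u).
Proof.
move=> t0 u1 /nearest_pointsE[Ax xmin]; split=> //= a Aa.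
by have := xmin _ Aa; rewrite addrAC subrr add0r enormZ u1 mulr1 ger0_norm.
Qed.

Lemma normal_bundle_touching A p : normal_bundle A p ->
  exists2 s, 0 < s & touching A s p.
Proof.
case: p => x u [y [/= [nAy _] yx uE]].
have xn : nearest_points A y x by rewrite yx.
have [Ax xE] := xn.
have y0 : 0 < edist y A.
  rewrite -xE lt_def enorm_ge0 andbT; apply/eqP => /(congr1 (fun z => z ^+ 2)).
  rewrite sqr_enorm expr0n => /dot_eq0/eqP; rewrite subr_eq0 => /eqP yE.
  by apply: nAy; rewrite yE.
exists (edist y A) => //; apply: nearest_touching; first exact: ltW.
  by rewrite uE enormZ xE normfV gtr0_norm// mulVf ?gt_eqF.
by rewrite uE scalerA divff ?gt_eqF// scale1r addrC subrK.
Qed.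

(** Trades the supremum in [local_reach] for the existence of a touching ball of radius beyond t;
    the measurability of the sets where the reach exceeds t rests on this form. *)
Lemma normal_bundleE A p t : 0 <= t ->
  (normal_bundle A p /\ (t%:E < local_reach A p.1 p.2)%E) <->
  exists2 s, t < s & touching A s p.
Proof.
case: p => x u /= t0; split.
  move=> [/normal_bundle_touching[s' _ [/= _ u1 _]]].
  move=> /ereal_sup_gt[_ [s [s0 sx] <-]]; rewrite lte_fin => ts.
  by exists s => //; apply: nearest_touching => //; rewrite sx.
move=> [s ts txu]; have s0 := le_lt_trans t0 ts; have [/= Ax u1 _] := txu.
(* The midpoint is below [s], so that the projection of [x + m *: u] is unique, and above [t], so
   that it witnesses a reach strictly beyond [t]; it is positive even for t = 0. *)
pose m := (t + s) / 2.
have m0 : 0 < m by rewrite /m; lra.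
have ms : m < s by rewrite /m; lra.
have [mx mE] := touching_nearest (ltW m0) ms txu.
split.
  exists (x + m *: u); split=> //=.
    split; last by exists x.
    move=> Ay; have := edist_le (x + m *: u) Ay.
    by rewrite mE subrr -(scale0r 0) enormZ normr0 mul0r leNgt m0.
  by rewrite mE addrAC subrr add0r scalerA mulVf ?gt_eqF// scale1r.
apply: (@lt_le_trans _ _ m%:E); first by rewrite lte_fin /m; lra.
by apply: ereal_sup_ubound; exists m => //; split=> //; exact: ltW.
Qed.

Lemma touching_reach A s p : 0 < s -> touching A s p ->
  normal_bundle A p /\ (s%:E <= local_reach A p.1 p.2)%E.
Proof.
move=> s0 ts.
have h t : 0 <= t -> t < s -> normal_bundle A p /\ (t%:E < local_reach A p.1 p.2)%E.
  by move=> t0 lts; apply/normal_bundleE => //; exists s.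
split; first by have [] := h 0 (lexx _) s0.
case E : local_reach => [l| |]; [|by rewrite leey|].
- rewrite lee_fin leNgt; apply/negP => ls.
  (* If the reach were a real l < s, the radius max(l, 0) would lie below [s] but not below the
     reach; the maximum with 0 supplies the nonnegativity asked by [h]. *)
  have [||_] := h (Num.max l 0); rewrite ?le_max ?lexx ?orbT ?gt_max ?ls//.
  by rewrite E lte_fin ltNge le_max lexx.
- by have [||_] := h 0; rewrite ?E.
Qed.

End euclidean_space.

(** * Limits and constants *)

Section limits_at_right_of_zero.
Context {R : realType}.
Implicit Types (f g : R -> \bar R).
Local Open Scope ereal_scope.

(** One inequality suffices: the opposite one is the same statement with f and g exchanged and r, c
    inverted. *)
Let limf_esup_scale_le f g (r c : R) : (0 < r)%R -> (0 < c)%R ->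
  (forall t, (0 < t)%R -> g (r * t)%R = c%:E * f t) ->
  limf_esup g 0^'+ <= c%:E * limf_esup f 0^'+.
Proof.
move=> r0 c0 gf; rewrite -lee_pdivrMl//.
apply: le_ereal_inf_tmp => _ [V V0 <-]; rewrite lee_pdivrMl//.
(* [W] is the dilate of [V] by [r], cut down to the positive points, where [gf] applies; it is still
   a right neighbourhood of 0. *)
pose W : set R := [set x | (0 < x)%R /\ V (r^-1 * x)%R].
apply: (@le_trans _ _ (ereal_sup (g @` W))).
  apply: ereal_inf_lbound; exists W => //.
  have [e /= e0 eV] := V0.
  exists (r * e)%R => /=; first exact: mulr_gt0.
  move=> x /= xe x0; split=> //; apply: eV; last by rewrite mulr_gt0// invr_gt0.
  move: xe; rewrite /ball/= !sub0r !normrN normrM normfV (gtr0_norm r0).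
  by rewrite ltr_pdivrMl.
apply: ge_ereal_sup => _ [x [x0 Vx] <-].
rewrite (_ : x = r * (r^-1 * x))%R; last by rewrite mulVKf ?gt_eqF.
rewrite gf ?mulr_gt0 ?invr_gt0// lee_pmul2l ?lte_fin//.
by apply: ereal_sup_ubound; exists (r^-1 * x)%R.
Qed.

Lemma limf_esup_scale f g (r c : R) : (0 < r)%R -> (0 < c)%R ->
  (forall t, (0 < t)%R -> g (r * t)%R = c%:E * f t) ->
  limf_esup g 0^'+ = c%:E * limf_esup f 0^'+.
Proof.
move=> r0 c0 gf; apply/eqP; rewrite eq_le (limf_esup_scale_le r0 c0 gf)/=.
rewrite -lee_pdivlMl//; apply: (@limf_esup_scale_le _ _ r^-1); rewrite ?invr_gt0//.
move=> t t0; rewrite -[in RHS](@mulVKf _ r _ t) ?gt_eqF// gf ?mulr_gt0 ?invr_gt0//.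
by rewrite muleA -EFinM mulVf ?gt_eqF// mul1e.
Qed.

Lemma limf_einf_scale f g (r c : R) : (0 < r)%R -> (0 < c)%R ->
  (forall t, (0 < t)%R -> g (r * t)%R = c%:E * f t) ->
  limf_einf g 0^'+ = c%:E * limf_einf f 0^'+.
Proof.
move=> r0 c0 gf; rewrite /limf_einf muleN; congr (- _).
by apply: (limf_esup_scale r0) => // t t0; rewrite gf// muleN.
Qed.

End limits_at_right_of_zero.

Section omega_neq0.
Context {R : realType}.

(** Half of the decay of e^(-t) absorbs the power, since t^y <= 1 + t^(n+1) <= M e^(t/2); the other
    half remains as an exponential density of rate 1/2. *)
Let powR_expR_le (y t : R) n : 0 <= y -> y <= n.+1%:R -> 0 < t ->
  t `^ y * expR (- t) <=
  2 * (2 ^+ n.+1 * n.+1`!%:R) * exponential_pdf 2^-1 t.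
Proof.
move=> y0 yn t0; rewrite exponential_pdfE ?(ltW t0)//.
have tE : expR (- t) = expR (- 2^-1 * t) * expR (- 2^-1 * t).
  by rewrite -expRD; congr expR; lra.
(* [M] is the reciprocal of the coefficient of t^(n+1) in the series of e^(t/2), so one term of that
   series dominates t^(n+1); M >= 1 takes care of the summand 1. *)
set M := 2 ^+ n.+1 * _.
have M1 : 1 <= M.
  by rewrite /M mulr_ege1// ?exprn_ege1// ?ler1n ?fact_gt0//; lra.
have : t `^ y <= 1 + t ^+ n.+1.
  have [t1|/ltW t1] := leP t 1.
    rewrite (@le_trans _ _ 1) ?lerDl ?exprn_ge0 ?(ltW t0)//.
    by rewrite -(powRr0 t) ger_powR ?t0.
  by rewrite -powR_mulrn ?(ltW t0)// ler_wpDl// ler_powR.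
have : 1 + t ^+ n.+1 <= M * expR (2^-1 * t).
  have := @expR_ge1Dxn R (2^-1 * t) n.
  rewrite pmulr_rge0// => /(_ (ltW t0)) h.
  apply: (@le_trans _ _ (M * (1 + (2^-1 * t) ^+ n.+1 / n.+1`!%:R))); last first.
    by rewrite ler_pM2l// (lt_le_trans _ M1).
  rewrite mulrDr mulr1 lerD// exprMn exprVn /M.
  rewrite -!mulrA [n.+1`!%:R * _]mulrCA [n.+1`!%:R * _]mulrCA.
  by rewrite divff ?pnatr_eq0 -?lt0n ?fact_gt0// mulr1 mulVKf// expf_neq0.
move=> h1 h2; have e0 := expR_gt0 (- 2^-1 * t).
have -> : 2 * M * (2^-1 * expR (- 2^-1 * t)) = M * expR (- 2^-1 * t) by lra.
rewrite tE mulrA ler_pM2r//.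
apply: (@le_trans _ _ (M * expR (2^-1 * t) * expR (- 2^-1 * t))).
  by rewrite ler_pM2r// (le_trans h2 h1).
by rewrite -mulrA -expRD mulNr addrN expR0 mulr1.
Qed.

Lemma Gamma_gt0 (x : R) : 1 <= x -> 0 < Gamma x.
Proof.
move=> x1; have y0 : 0 <= x - 1 by rewrite subr_ge0.
pose n := Num.bound (x - 1); have yn : x - 1 <= n.+1%:R.
  by rewrite (le_trans (ltW (archi_boundP y0)))// ler_nat leqnSn.
pose f t := t `^ (x - 1) * expR (- t).
have mf D : measurable_fun D (EFin \o f).
  apply: measurable_funTS; apply/measurable_EFinP; apply: measurable_funM.
    exact: measurable_powR.
  by apply: measurableT_comp => //; exact: measurable_expR.
have f0 t : 0 <= f t by rewrite mulr_ge0 ?powR_ge0 ?expR_ge0.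
(* [fine] sends +oo to 0, so finiteness is needed besides positivity. The integrand is at least
   e^(-2) on [1, 2], and the exponential density bounds it from above. *)
rewrite /Gamma /Rintegral fine_gt0//; apply/andP; split.
  apply: (@lt_le_trans _ _
    (\int[lebesgue_measure]_(t in `[1%R, 2%R]) (expR (- 2 : R))%:E)%E).
    rewrite integral_cst//= lebesgue_measure_itv/= lte_fin ltr1n/=.
    by rewrite -EFinB -EFinM lte_fin mulr_gt0 ?expR_gt0//; lra.
  apply: (@le_trans _ _ (\int[lebesgue_measure]_(t in `[1%R, 2%R]) (f t)%:E)%E).
    apply: ge0_le_integral => //= [|t]; first exact: mf.
    rewrite in_itv/= => /andP[t1 t2]; rewrite lee_fin /f.
    rewrite -[leLHS]mul1r ler_pM ?expR_ge0 ?ler_expR ?lerN2//.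
    by have := ler_powR t1 y0; rewrite powRr0.
  refine (@ge0_subset_integral _ _ _ lebesgue_measure `[1%R,2%R] `]0%R, +oo[ _ _
    (EFin \o f) (mf _) _ _) => //= [t _|t]; first by rewrite lee_fin f0.
  by rewrite /= !in_itv/= andbT => /andP[t1 _]; lra.
set M := 2 * (2 ^+ n.+1 * n.+1`!%:R) : R.
have mp : measurable_fun [set: R] (fun t => (M * exponential_pdf 2^-1 t)%:E).
  apply/measurable_EFinP; apply: measurable_funM => //.
  exact: measurable_exponential_pdf.
have M0 : 0 <= M by apply: mulr_ge0 => //; apply: mulr_ge0 => //; exact: exprn_ge0.
have e0 t : 0 <= exponential_pdf (2^-1 : R) t by exact: exponential_pdf_ge0.
have p0 t : (0 <= (M * exponential_pdf 2^-1 t)%:E)%E by rewrite lee_fin mulr_ge0.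
apply: (@le_lt_trans _ _
  (\int[lebesgue_measure]_(t in [set: R]) (M * exponential_pdf 2^-1 t)%:E)%E).
  apply: (@le_trans _ _ (\int[lebesgue_measure]_(t in `]0%R, +oo[)
    (M * exponential_pdf 2^-1 t)%:E)%E).
    apply: ge0_le_integral => //= [t _| | |t].
    - by rewrite lee_fin f0.
    - exact: mf.
    - exact: measurable_funTS.
    by rewrite in_itv/= andbT => t0; rewrite lee_fin powR_expR_le.
  exact: ge0_subset_integral.
under eq_integral do rewrite EFinM.
rewrite ge0_integralZl//= ?lee_fin//.
- by rewrite integral_exponential_pdf ?mule1 ?ltry// invr_gt0.
- by apply/measurable_EFinP; exact: measurable_exponential_pdf.
- by move=> t _; rewrite lee_fin.
Qed.

(** Allows the constants to be cancelled when the coefficients of two Steiner formulas are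
    compared. *)
Lemma omega_neq0 k : (0 < k)%N -> omega k != 0 :> R.
Proof.
move=> k0; rewrite /omega mulf_neq0//; first by rewrite pnatr_eq0 -lt0n.
rewrite /kappa gt_eqF// divr_gt0 ?powR_gt0 ?pi_gt0//.
by rewrite Gamma_gt0// lerDr divr_ge0.
Qed.
End omega_neq0.

(** * Lebesgue measure under dilations *)

Section measure_transport.
Context d1 d2 (T1 : measurableType d1) (T2 : measurableType d2) (R : realType).

Definition image_measure (m : {measure set T1 -> \bar R}) (f : T1 -> T2)
    (mf : measurable_fun setT f) : {measure set T2 -> \bar R} :=
  measure_function_pushforward__canonical__measure_function_Measure m mf.

Definition scaled_measure (c : {nonneg R}) (m : {measure set T1 -> \bar R}) :
  {measure set T1 -> \bar R} := mscale c m.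

End measure_transport.

Section lebesgue_dilation.
Context {R : realType}.
Local Notation mR := (measurableTypeR R).
Variables (c : R) (c0 : 0 < c).
Let cn : {nonneg R} := NngNum (ltW c0).
Local Open Scope ereal_scope.

Let dil (x : mR) : mR := (c * x)%R.

Let measurable_dil : measurable_fun setT dil.
Proof. exact: mulrl_measurable. Qed.

(** Both sides are measures in X with the same values on half-open intervals, which determine
    Lebesgue measure. *)
Lemma lebesgue_measure_dilation (X : set mR) : measurable X ->
  c%:E * lebesgue_measure (dil @^-1` X) = lebesgue_measure X.
Proof.
move=> mX; apply/esym.
apply: (@lebesgue_measure_unique R
  (scaled_measure cn (image_measure lebesgue_measure measurable_dil))) => //.
move=> _ [[a b] _ <-] /=; rewrite /mscale/= /pushforward.
have -> : dil @^-1` `]a, b] = `](c^-1 * a)%R, (c^-1 * b)%R]%classic.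
  by apply/seteqP; split=> x; rewrite /= !in_itv/= ltr_pdivrMl// ler_pdivlMl.
rewrite !lebesgue_measure_itv/= !lte_fin ltr_pM2l ?invr_gt0//.
by case: ifPn; rewrite ?mule0// -!EFinB -EFinM -mulrBr mulVKf ?gt_eqF.
Qed.

Definition dilation_tuple n (t : n.-tuple mR) : n.-tuple mR := [tuple of map dil t].

Lemma measurable_dilation_tuple n : measurable_fun setT (@dilation_tuple n).
Proof.
apply/measurable_fun_tnthP => i.
rewrite (_ : _ \o _ = dil \o (fun t => tnth t i)).
  by apply: measurableT_comp => //; exact: measurable_tnth.
by apply/funext => t /=; rewrite tnth_map.
Qed.

(** Induction on n: the rescaled image of the product measure has the right values on rectangles,
    hence is the product measure by uniqueness. *)
Lemma lebesgue_tuple_dilation n (X : set (n.-tuple mR)) : measurable X ->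
  (c ^+ n)%:E * lebesgue_tuple n (@dilation_tuple n @^-1` X) = lebesgue_tuple n X.
Proof.
elim: n X => [|n IH] X mX.
  rewrite expr0 mul1e; congr (lebesgue_tuple 0 _).
  by apply/seteqP; split=> t; rewrite (tuple0 t) /preimage/= (tuple0 (dilation_tuple _)).
pose F (p : mR * n.-tuple mR) := (dil p.1, @dilation_tuple n p.2).
have mF : measurable_fun setT F.
  apply: measurable_fun_pair => /=; first exact: measurableT_comp.
  by apply: measurableT_comp => //; exact: measurable_dilation_tuple.
pose cn1 : {nonneg R} := NngNum (exprn_ge0 n.+1 (ltW c0)).
have mX' : measurable (@tuple_cons R n @^-1` X).
  by rewrite -[X in measurable X]setTI; exact: measurable_tuple_cons.
transitivity ((lebesgue_measure \x lebesgue_tuple n) (@tuple_cons R n @^-1` X)); last by [].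
rewrite (@product_measure_unique _ _ _ _ _ lebesgue_measure (lebesgue_tuple n)
  (scaled_measure cn1 (image_measure (lebesgue_measure \x lebesgue_tuple n) mF)) _ _ mX').
  rewrite /= /mscale /= /lebesgue_step /pushforward.
  congr (_ * (_ \x _) _).
  by apply/seteqP; split=> -[x t] /=; rewrite /preimage/=; congr X; apply: val_inj.
move=> A B mA mB; rewrite /= /mscale /= /pushforward.
have -> : F @^-1` (A `*` B) = (dil @^-1` A) `*` (@dilation_tuple n @^-1` B) by [].
rewrite product_measure1E; last 2 first.
- by rewrite -[X in measurable X]setTI; exact: measurable_dil.
- by rewrite -[X in measurable X]setTI; exact: measurable_dilation_tuple.
by rewrite exprS EFinM muleACA lebesgue_measure_dilation// IH.
Qed.

End lebesgue_dilation.

Lemma lebesgue_rV_dilation (R : realType) n (c : R) (X : set 'rV[R]_n) :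
  0 < c -> measurable X -> 
  lebesgue_rV [set c *: x | x in X] = ((c ^+ n)%:E * lebesgue_rV X)%E.
Proof.
move=> c0 mX; have mX' : measurable (@rV_of_tuple R n @^-1` X).
  by rewrite -[X in measurable X]setTI; exact: measurable_rV_of_tuple.
(* The image under the dilation by c is the preimage under the dilation by c^-1, so the result on
   tuples is applied to c^-1. *)
have ci0 : 0 < c^-1 by rewrite invr_gt0.
rewrite /lebesgue_rV /pushforward -(lebesgue_tuple_dilation ci0 mX').
rewrite muleA -EFinM -exprMn mulfV ?gt_eqF// expr1n mul1e.
congr (lebesgue_tuple n _).
have E t : rV_of_tuple (@dilation_tuple R c^-1 n t) = c^-1 *: rV_of_tuple t.
  by apply/rowP => i; rewrite !mxE tnth_map.
apply/seteqP; split=> t; rewrite /preimage/= E.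
  by move=> [x Xx <-]; rewrite scalerA mulVf ?gt_eqF// scale1r.
by move=> Xt; exists (c^-1 *: rV_of_tuple t) => //; rewrite scalerA mulfV ?gt_eqF// scale1r.
Qed.

(** * Borel sets and maps *)

Section borel_maps.
Context {R : realType} {d : nat}.
Notation V := 'rV[R]_d.

Lemma rV_borel_open (U : set V) : open U -> measurable U.
Proof. by move=> oU; exact: sub_sigma_algebra. Qed.

Lemma rV_borel_closed (F : set V) : closed F -> measurable F.
Proof.
move=> cF; rewrite -[F]setCK; apply: measurableC; apply: rV_borel_open.
exact: closed_openC.
Qed.

Lemma rV_borel_gen_closed : @measurable _ V = <<s @closed V >>.
Proof.
apply/seteqP; split.
  apply: smallest_sub; first exact: smallest_sigma_algebra.
  move=> U oU; rewrite -[U]setCK; apply: sigma_algebraC.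
  by apply: sub_sigma_algebra; exact: open_closedC.
apply: smallest_sub; first exact: sigma_algebra_measurable.
by move=> F; exact: rV_borel_closed.
Qed.

Lemma rV_continuous_measurable (f : V -> R) : continuous f -> measurable_fun setT f.
Proof.
move=> cf; apply: (measurability _ (RGenOpens.measurableE R)) => //.
move=> _ [_ [a [b ->]] <-]; rewrite setTI; apply: rV_borel_open.
by move/continuousP : cf; apply; exact: interval_open.
Qed.

Lemma rV_measurable_coord i : measurable_fun setT (fun x : V => x ord0 i).
Proof. by apply: rV_continuous_measurable => x; exact: coord_continuous. Qed.

Lemma rV_measurable_fun d' (T : measurableType d') (f : T -> V) :
  (forall i, measurable_fun setT (fun t => f t ord0 i)) -> measurable_fun setT f.
Proof.
move=> mf.
rewrite (_ : f = @rV_of_tuple R d \o (fun t => [tuple f t ord0 i | i < d])); last first.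
  by apply/funext => t; apply/rowP => i; rewrite mxE tnth_mktuple.
apply: measurableT_comp; first exact: measurable_rV_of_tuple.
apply/measurable_fun_tnthP => i.
rewrite (_ : _ \o _ = (fun t => f t ord0 i)); first exact: mf.
by apply/funext => t /=; rewrite tnth_mktuple.
Qed.

Lemma rV_measurable_scale (c : R) : measurable_fun setT (fun x : V => c *: x).
Proof.
apply: rV_measurable_fun => i; under eq_fun do rewrite mxE.
by apply: measurable_funM; [exact: measurable_cst|exact: rV_measurable_coord].
Qed.

Lemma rV_measurable_shift (s : R) : measurable_fun setT (fun p : V * V => p.1 + s *: p.2).
Proof.
apply: rV_measurable_fun => i; under eq_fun do rewrite !mxE.
apply: measurable_funD.
  by apply: (measurableT_comp (rV_measurable_coord i)); exact: measurable_fst.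
apply: measurable_funM; first exact: measurable_cst.
by apply: (measurableT_comp (rV_measurable_coord i)); exact: measurable_snd.
Qed.

Lemma rV_shift_continuous : continuous (fun q : (V * V) * R => q.1.1 + q.2 *: q.1.2).
Proof.
move=> q; apply: cvgD.
  by apply: (cvg_comp _ _ cvg_fst); exact: cvg_fst.
apply: cvgZ; first exact: cvg_snd.
by apply: (cvg_comp _ _ cvg_fst); exact: cvg_snd.
Qed.

(** Closed rectangles are stable under intersection and meet a compact set in a compact set, which
    suits the comparison of measures in [pos_neg_part_dilation]. One factor is treated at a time, by
    the good-sets principle. *)
Lemma rV_prod_gen_closed :
  @measurable _ (V * V)%type = <<s [set A `*` B | A in @closed V & B in @closed V] >>.
Proof.
rewrite measurable_prod_measurableType; apply/seteqP; split.
  apply: smallest_sub; first exact: smallest_sigma_algebra.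
  set G := <<s _ >>.
  move=> _ [A mA [B mB <-]].
  have hA : G (A `*` setT).
    move: A mA; rewrite rV_borel_gen_closed.
    apply: (@smallest_sub _ _ _ [set A | G (A `*` setT)]).
      split.
      - by rewrite /= set0X; exact: sigma_algebra0.
      - move=> A GA /=.
        rewrite (_ : _ `*` _ = setT `\` (A `*` setT)); first exact: sigma_algebraCD.
        by apply/seteqP; split=> [[x y] /= [[_ nAx] _]|[x y] /= [_ nAx]];
          split=> //; tauto.
      - move=> F GF /=; rewrite setX_bigcupl; exact: sigma_algebra_bigcup.
    move=> A cA; apply: sub_sigma_algebra.
    by exists A => //; exists setT => //; exact: closedT.
  have hB : G (setT `*` B).
    move: B mB; rewrite rV_borel_gen_closed.
    apply: (@smallest_sub _ _ _ [set A | G (setT `*` A)]).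
      split.
      - by rewrite /= setX0; exact: sigma_algebra0.
      - move=> B GB /=.
        rewrite (_ : _ `*` _ = setT `\` (setT `*` B)); first exact: sigma_algebraCD.
        by apply/seteqP; split=> [[x y] /= [_ [_ nBy]]|[x y] /= [_ nBy]];
          split=> //; tauto.
      - move=> F GF /=; rewrite setX_bigcupr; exact: sigma_algebra_bigcup.
    by move=> B cB; apply: sub_sigma_algebra; exists setT; [exact: closedT|exists B].
  rewrite (_ : A `*` B = (A `*` setT) `&` (setT `*` B)); last first.
    by apply/seteqP; split=> [[x y] /= []|[x y] /= [[? _] [_ ?]]].
  exact: (@measurableI _ (g_sigma_algebraType
    [set A `*` B | A in @closed V & B in @closed V])).
apply: smallest_sub; first exact: smallest_sigma_algebra.
move=> _ [A cA [B cB <-]]; apply: sub_sigma_algebra.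
by exists A; [exact: rV_borel_closed|exists B => //; exact: rV_borel_closed].
Qed.

End borel_maps.

(** * Measurability and compactness of the touching sets *)

Section touching_topology.
Context {R : realType} {d : nat}.
Notation V := 'rV[R]_d.
Variables (A : set V) (A0 : A !=set0) (cA : compact A).

Let closedA : closed A.
Proof. exact: (compact_closed (@norm_hausdorff _ _)). Qed.

(** Expresses the touching pairs by three closed conditions, from which both measurability and
    compactness are read off. *)
Lemma touchingE s : touching A s = [set p | A p.1] `&` [set p | enorm p.2 = 1] `&`
  [set p | s <= edist (p.1 + s *: p.2) A].
Proof.
apply/seteqP; split=> p.
  by move=> [Ap u1 sA]; split=> //; apply/(le_edist _ _ A0).
by move=> [[Ap u1] /(le_edist _ _ A0) sA].
Qed.

Lemma measurable_touching s : measurable (touching A s).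
Proof.
have mdist : measurable_fun setT (fun p : V * V => edist (p.1 + s *: p.2) A).
  have me := rV_continuous_measurable (continuous_edist A0).
  exact: (measurableT_comp me (rV_measurable_shift s)).
have mnorm : measurable_fun setT (fun p : V * V => enorm p.2).
  have me := rV_continuous_measurable (@enorm_continuous R d).
  exact: (measurableT_comp me measurable_snd).
rewrite touchingE; apply: measurableI; first apply: measurableI.
- rewrite -[X in measurable X]setTI.
  by apply: measurable_fst => //; exact: rV_borel_closed.
- rewrite -[X in measurable X]setTI.
  exact: (mnorm measurableT _ (measurable_set1 1)).
- rewrite -[X in measurable X]setTI.
  rewrite (_ : [set p : V * V | _] =
    (fun p => edist (p.1 + s *: p.2) A) @^-1` `[s, +oo[); last first.
    by apply/seteqP; split=> p; rewrite /preimage/= in_itv/= andbT.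
  exact: (mdist measurableT _ (measurable_itv _)).
Qed.

Lemma compact_touching s : compact (touching A s).
Proof.
have cS : compact [set u : V | enorm u = 1].
  apply: bounded_closed_compact.
    exists 1; split=> // M M1 u /= u1.
    (* Boundedness refers to the sup norm, and each entry is bounded by the Euclidean norm. *)
    rewrite [leLHS]/Num.norm/= mx_normrE; apply/bigmax_leP; split.
      by rewrite ltW// (lt_trans _ M1).
    move=> [i j] _ /=; rewrite ord1 (le_trans _ (ltW M1))// -u1.
    rewrite -(@ler_pXn2r _ 2) ?nnegrE ?enorm_ge0// sqr_enorm real_normK ?num_real//.
    by rewrite /dot (bigD1 j)//= -expr2 lerDl sumr_ge0// => k _; exact: sqr_ge0.
  apply: (preimage_closed (f := @enorm R d) (D := [set 1])) => // u _.
  exact: enorm_continuous.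
apply: (subclosed_compact _ (compact_setX cA cS)); last by move=> [x u] [].
have cnorm : continuous (fun p : V * V => enorm p.2).
  by move=> p; apply: (cvg_comp _ _ cvg_snd); exact: enorm_continuous.
have cdist : continuous (fun p : V * V => edist (p.1 + s *: p.2) A).
  move=> p.
  apply: (cvg_comp (fun p : V * V => p.1 + s *: p.2) (fun y => edist y A));
    last exact: continuous_edist.
  apply: cvgD; first exact: cvg_fst.
  by apply: cvgZl_tmp; exact: cvg_snd.
rewrite touchingE; apply: closedI; first apply: closedI.
- by apply: (preimage_closed (f := @fst V V) (D := A)) => // p _; exact: cvg_fst.
- apply: (preimage_closed (f := fun p : V * V => enorm p.2) (D := [set 1])) => //.
- apply: (preimage_closed (f := fun p : V * V => edist (p.1 + s *: p.2) A)
    (D := [set x | s <= x])).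
    by move=> p _; exact: cdist.
  exact: closed_ge.
Qed.

End touching_topology.

(** * The Steiner formula on tubes *)

Section steiner.
Context {R : realType} {d : nat}.
Notation V := 'rV[R]_d.

(* [ge0_le_integral] would ask for the measurability of the local reach. *)
Lemma le_integralT d' (T : measurableType d') (m : {measure set T -> \bar R})
    (f g : T -> \bar R) :
  (forall x, 0 <= f x)%E -> (forall x, f x <= g x)%E ->
  (\int[m]_x f x <= \int[m]_x g x)%E.
Proof.
move=> f0 fg; rewrite !ge0_integralTE//; last by move=> x; exact: le_trans (f0 x) (fg x).
by apply: le_ereal_sup => _ [h hf <-]; exists h => // x; exact: le_trans (hf x) (fg x).
Qed.

(** Extension by zero off [D] leaves a multiple of the indicator of [C], so measurability is asked
    of [C] alone; [D] will be the normal bundle. *)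
Lemma integral_indic_sub d' (T : measurableType d') (m : {measure set T -> \bar R})
    (D C : set T) (g : T -> \bar R) (c : R) : 0 <= c -> measurable C -> C `<=` D ->
  (forall x, D x -> g x = (c * \1_C x)%:E) ->
  (\int[m]_(x in D) g x = c%:E * m C)%E.
Proof.
move=> c0 mC CD gE; rewrite integral_mkcond.
rewrite (eq_integral (fun x => c%:E * (\1_C x)%:E)%E); last first.
  move=> x _; rewrite patchE; case: ifPn; rewrite ?inE ?notin_setE => Dx.
    by rewrite gE.
  by rewrite indicE memNset ?mule0// => /CD.
rewrite ge0_integralZl_EFin//; last by apply/measurable_EFinP; exact: measurable_indic.
by rewrite integral_indic// setIT.
Qed.

Lemma integral_indic_fin d' (T : measurableType d') (m : {measure set T -> \bar R})
    (D C : set T) (g : T -> \bar R) (c : R) : 0 <= c -> measurable C -> C `<=` D ->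
  (forall x, D x -> g x = (c * \1_C x)%:E) -> (m C < +oo)%E ->
  (\int[m]_(x in D) g x = (c * fine (m C))%:E)%E.
Proof.
move=> c0 mC CD gE mCfin.
by rewrite (integral_indic_sub _ c0 mC CD gE) EFinM fineK// ge0_fin_numE.
Qed.

Lemma integral_pow_itv (c a b : R) k : 0 < a -> a < b -> (0 < k)%N ->
  (\int[lebesgue_measure]_(t in `]0%R, +oo[) (t ^+ k.-1 * \1_(`[a, b]) t * c)%:E =
   (c * ((b ^+ k - a ^+ k) / k%:R))%:E)%E.
Proof.
move=> a0 ab k0.
transitivity (\int[lebesgue_measure]_(t in `[a, b]) (c * t ^+ k.-1)%:E)%E.
  rewrite integral_mkcond [RHS]integral_mkcond; apply: eq_integral => t _.
  rewrite !patchE !mem_setE/= !in_itv/= andbT indicE mem_setE/= in_itv/=.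
  have [/andP[at_ tb]|] := boolP (a <= t <= b).
    by rewrite (lt_le_trans a0 at_) mulr1 mulrC.
  by case: ifP => // _; rewrite mulr0 mul0r.
have dF (t : R) : is_derive t (1 : R) (fun t : R => c * (t ^+ k / k%:R)) (c * t ^+ k.-1).
  have := is_deriveZ (c / k%:R) (is_deriveX k (is_derive_id t (1 : R))).
  rewrite (_ : _ \*: _ = fun t : R => c * (t ^+ k / k%:R)); last first.
    apply/funext => x; rewrite /GRing.scale/= (_ : (id ^+ k) x = x ^+ k);
      last by rewrite exprfctE.
    by transitivity (c / k%:R * x ^+ k) => //; rewrite mulrAC mulrA.
  move=> h; apply: (is_derive_eq h).
  rewrite /GRing.scale/= mulr1 mulrA; congr (_ * _).
  by rewrite divfK// pnatr_eq0 -lt0n.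
rewrite (@continuous_FTC2 _ (fun t => c * t ^+ k.-1) (fun t => c * (t ^+ k / k%:R)))//.
- by rewrite -EFinB -mulrBr -mulrBl.
- apply: derivable_within_continuous => t _.
  by apply: derivableM; [exact: derivable_cst|exact: exprn_derivable].
- have cF : continuous (fun t : R => c * (t ^+ k / k%:R)).
    move=> t; apply: differentiable_continuous; apply/derivable1_diffP.
    exact: (@ex_derive _ _ _ _ _ _ _ (dF t)).
  split=> [t _||].
  - exact: (@ex_derive _ _ _ _ _ _ _ (dF t)).
  - exact/cvg_at_right_filter/cF.
  - exact/cvg_at_left_filter/cF.
- by move=> t _; rewrite derive1E; apply: derive_val.
Qed.

Lemma total_variationE d' (T : measurableType d') (nu : signed_measure R T) C :
  (total_variation nu C = pos_part nu C + neg_part nu C)%E.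
Proof. exact: measure_addE. Qed.

Variables (A : set V) (A0 : A !=set0) (cA : compact A).
Variables (mu : 'I_d -> signed_measure R (V * V)%type).
Hypothesis mu_support : is_support_measures A mu.

(** On [touching A s] the local reach is at least s, so the integrand of [support_integrable] with B
    = A and radius s equals s^(d-i) there. *)
Lemma total_variation_touching i s : 0 < s ->
  (total_variation (mu i) (touching A s) < +oo)%E.
Proof.
move=> s0; have mt := measurable_touching A0 cA s.
have := support_integrable mu_support i cA s0.
set I := integral _ _ _.
suff : ((s ^+ (d - i))%:E * total_variation (mu i) (touching A s) <= I)%E.
  move=> /le_lt_trans h /h; rewrite -lte_pdivlMl ?exprn_gt0// => /lt_le_trans; apply.
  by rewrite leey.
rewrite -(@integral_indic_sub _ _ _ setT _
  (fun p => (s ^+ (d - i) * \1_(touching A s) p)%:E)) ?exprn_ge0 ?(ltW s0)//.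
rewrite /I [leRHS]integral_mkcond; apply: le_integralT => p.
  by rewrite lee_fin mulr_ge0 ?exprn_ge0 ?(ltW s0).
rewrite patchE indicE; have [/[!inE] tp|_] := boolP (p \in touching A s); last first.
  rewrite mulr0; case: ifPn => // /[!inE] Np; rewrite mule_ge0 ?lee_fin// expe_ge0//.
  rewrite le_min lee_fin (ltW s0)/=.
  have [e e0 te] := normal_bundle_touching Np.
  by rewrite (le_trans _ (touching_reach e0 te).2)// lee_fin ltW.
have [Np rp] := touching_reach s0 tp; rewrite mem_set//.
have [/= Ap _ _] := tp.
by rewrite indicE mem_set// mul1e mulr1 min_l// EFin_expe.
Qed.

Lemma signed_mass_fin i s C : 0 < s -> measurable C -> C `<=` touching A s ->
  (pos_part (mu i) C < +oo)%E /\ (neg_part (mu i) C < +oo)%E.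
Proof.
move=> s0 mC Cs; have : (total_variation (mu i) C < +oo)%E.
  apply: le_lt_trans (total_variation_touching i s0).
  by apply: le_measure => //; rewrite inE//; exact: measurable_touching.
rewrite total_variationE => h.
by split; apply: le_lt_trans h; rewrite ?leeDl ?leeDr.
Qed.

Definition tube (C : set (V * V)) (a b : R) : set V :=
  [set q.1.1 + q.2 *: q.1.2 | q in C `*` `[a, b]].

(** Injectivity of (x, u, t) |-> x + t u: x is recovered as the nearest point, t as the distance to
    A, and u as the remaining direction. *)
Lemma tubeP (C : set (V * V)) (a b s t : R) p : 0 < a -> b < s -> C `<=` touching A s ->
  0 < t -> normal_bundle A p -> (t%:E < local_reach A p.1 p.2)%E ->
  tube C a b (p.1 + t *: p.2) <-> C p /\ a <= t <= b.
Proof.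
case: p => x u a0 bs Cs t0 Np tp; split=> [|[Cp tab]]; last first.
  by exists ((x, u), t) => //; split=> //=; rewrite in_itv.
have [s' ts' xus'] : exists2 s', t < s' & touching A s' (x, u).
  by apply/normal_bundleE => //; exact: ltW.
move=> [[[y v] t'] [/= Cq]]; rewrite in_itv/= => /andP[at' t'b] E.
have [xE tE] := touching_nearest (ltW t0) ts' xus'.
have [||yE t'E] := @touching_nearest _ _ A s t' y v _ _ (Cs _ Cq).
- by rewrite (le_trans (ltW a0)).
- by rewrite (le_lt_trans t'b).
move: yE t'E; rewrite E xE tE => xy tt'.
have {}xy : x = y by have : [set y] x by rewrite -xy.
move: E; rewrite -xy -tt' => /addrI/(congr1 (fun z => t^-1 *: z)).
rewrite !scalerA mulVf ?gt_eqF// !scale1r => vu.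
by rewrite {1}xy -vu tt' at' t'b.
Qed.

(** The value mu_i(A; C), meaningful when both parts are finite on C, as on Borel subsets of
    [touching A s] for s > 0. *)
Definition signed_mass i (C : set (V * V)) : R :=
  fine (pos_part (mu i) C) - fine (neg_part (mu i) C).

(** By [tubeP] the indicator of the tube splits into one factor in (x, u) and one in t: the inner
    integral of the Steiner formula yields mu_i(A; C), the outer one a difference of powers. *)
Lemma lebesgue_tube (C : set (V * V)) (a b s : R) : 0 < a -> a < b -> b < s ->
  measurable C -> compact C -> C `<=` touching A s ->
  (lebesgue_rV (tube C a b) =
   (\sum_(i < d) omega (d - i) *
      (signed_mass i C * ((b ^+ (d - i) - a ^+ (d - i)) / (d - i)%:R)))%:E)%E.
Proof.
move=> a0 ab bs mC cC Cs.
have s0 : 0 < s by rewrite (lt_trans a0)// (lt_trans ab).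
set K := tube C a b.
have cK : compact K.
  have cCab : compact (C `*` `[a, b]) by exact: (compact_setX cC (@segment_compact R a b)).
  exact: (continuous_compact (continuous_subspaceT (@rV_shift_continuous R d)) cCab).
have clK : closed K by exact: (compact_closed (@norm_hausdorff _ _)).
have clA : closed A by exact: (compact_closed (@norm_hausdorff _ _)).
have mK : measurable K by exact: rV_borel_closed.
(* Points of the tube have distance at least a > 0 from A, so integrating over the complement of A
   loses nothing of [K]. *)
have KA : K `&` ~` A = K.
  apply/seteqP; split=> [y []//|y [[[x u] t] [/= Cxu]]].
  rewrite in_itv/= => /andP[at_ tb] <-; split; first by exists ((x, u), t) => //; split=> //=; rewrite in_itv/= at_.
  have t0 := lt_le_trans a0 at_.
  have [_ tE] := touching_nearest (ltW t0) (le_lt_trans tb bs) (Cs _ Cxu).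
  move=> /(edist_le (x + t *: u)).
  by rewrite tE subrr -(scale0r 0) enormZ normr0 mul0r leNgt t0.
have suppK : [set x | \1_K x != 0 :> R] = K.
  apply/seteqP; split=> x; rewrite /= indicE.
    by case: (boolP (x \in K)); rewrite ?inE// eqxx.
  by move=> Kx; rewrite mem_set// oner_eq0.
have bK : exists M : R, forall x, `|\1_K x| <= M.
  by exists 1 => x; rewrite indicE; case: (_ \in _); rewrite ?normr1 ?normr0.
have csK : compact (closure [set x | \1_K x != 0 :> R]).
  by rewrite suppK -((closure_id K).1 clK).
have := support_steiner mu_support (measurable_indic mK) bK csK.
rewrite integral_indic//; last by apply: measurableC; exact: rV_borel_closed.
rewrite KA => ->; rewrite -sumEFin; apply: eq_bigr => i _.
rewrite [RHS]EFinM; congr (_ * _)%E.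
rewrite -(integral_pow_itv (signed_mass i C) a0 ab) ?subn_gt0//.
apply: eq_integral => t; rewrite inE/= in_itv/= andbT => t0.
have [pf nf] := signed_mass_fin i s0 mC Cs.
have ti0 : 0 <= t ^+ (d - i).-1 * \1_(`[a, b]) t.
  by rewrite mulr_ge0 ?exprn_ge0 ?(ltW t0)//.
have gE p : normal_bundle A p ->
    (t ^+ (d - i).-1 * (t%:E < local_reach A p.1 p.2)%E%:R * \1_K (p.1 + t *: p.2))%:E =
    (t ^+ (d - i).-1 * \1_(`[a, b]) t * \1_C p)%:E.
  move=> Np; congr EFin; rewrite -!mulrA; congr (_ * _).
  have [tp|] := boolP (t%:E < local_reach A p.1 p.2)%E.
    have tubeE := tubeP a0 bs Cs t0 Np tp.
    rewrite mul1r !indicE -natrM mulnb; congr (nat_of_bool _)%:R.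
    apply/idP/andP => [|[]]; rewrite !inE/= in_itv/=.
      by move=> /tubeE[].
    by move=> tab Cp; apply/tubeE.
  (* When t is not below the reach, the right side vanishes too: a pair in [C] has reach at least s
     > b, which rules out t <= b. *)
  move=> ntp; rewrite mul0r !indicE.
  have [tab|] := boolP (t \in `[a, b]%classic); last by rewrite mul0r.
  have [/[!inE] Cp|] := boolP (p \in C); last by rewrite mulr0.
  move: ntp => /negP; case; have [_] := touching_reach s0 (Cs _ Cp).
  move=> /(lt_le_trans _); apply; rewrite lte_fin.
  by move: tab; rewrite inE/= in_itv/= => /andP[_ /le_lt_trans]; apply.
have CN : C `<=` normal_bundle A by move=> p /Cs /(touching_reach s0)[].
rewrite /signed_integral (integral_indic_fin ti0 mC CN gE pf).
by rewrite (integral_indic_fin ti0 mC CN gE nf) -EFinB -mulrBr.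
Qed.

End steiner.

(** * Comparison of the support measures of A and rA *)

(** The sum is a polynomial in b that vanishes on an interval, hence is zero. As d - i >= 1, the
    constant term does not affect the coefficient of X^(d-i), and distinct i give distinct
    powers. *)
Lemma sum_pow_eq0 (R : realType) d (g : 'I_d -> R) (a s : R) : a < s ->
  (forall b, a < b -> b < s ->
     \sum_(i < d) g i * (b ^+ (d - i) - a ^+ (d - i)) = 0) ->
  forall i, g i = 0.
Proof.
move=> as_ gE i.
pose p : {poly R} :=
  \sum_(i < d) g i *: 'X^(d - i) - (\sum_(i < d) g i * a ^+ (d - i))%:P.
have pb b : a < b -> b < s -> root p b.
  move=> ab bs; apply/rootP; rewrite -[RHS](gE b ab bs) !hornerE horner_sum.
  by rewrite -sumrB; apply: eq_bigr => j _; rewrite !hornerE mulrBr.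
have p0 : p = 0.
  apply/eqP/negPn/negP => p0.
  (* These [size p] distinct roots exceed the degree. The denominators start at 2, since 1 would
     give the excluded endpoint [s]. *)
  pose rs := [seq a + (s - a) / n.+2%:R | n <- iota 0 (size p)].
  suff : (size rs < size p)%N by rewrite size_map size_iota ltnn.
  apply: max_poly_roots => //.
    apply/allP => _ /mapP[n _ ->]; apply: pb.
      by rewrite ltrDl divr_gt0// subr_gt0.
    by rewrite -ltrBrDl ltr_pdivrMr// ltr_pMr ?subr_gt0// ltr1n.
  have sa0 : s - a != 0 by rewrite subr_eq0 gt_eqF.
  rewrite map_inj_uniq ?iota_uniq// => m n /addrI/(mulfI sa0)/invr_inj mn.
  have : m.+2%:R == n.+2%:R :> R by rewrite mn.
  by rewrite eqr_nat => /eqP[].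
have := congr1 (fun q : {poly R} => q`_(d - i)) p0.
rewrite /p coef0 coefB coefC subn_eq0 leqNgt ltn_ord/= subr0 coef_sum.
rewrite (bigD1 i)//= coefZ coefXn eqxx mulr1 big1 ?addr0// => j ji.
rewrite coefZ coefXn; case: eqP => [ij|]; last by rewrite mulr0.
case/eqP: ji; apply/val_inj => /=.
by rewrite -(subKn (ltnW (ltn_ord j))) -ij subKn// ltnW.
Qed.

(** * Uniqueness of the Jordan decomposition *)

Section jordan.
Context d (T : measurableType d) (R : realType).
Local Open Scope ereal_scope.

(** All of p sits on S, where n vanishes; on the part of E inside S the balance reads p + n' = p',
    whence p <= p'. *)
Lemma singular_part_le (p n p' n' : {measure set T -> \bar R}) (S D : set T) :
  measurable S -> p (~` S) = 0 -> n S = 0 ->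
  (forall E, measurable E -> E `<=` D -> p E + n' E = n E + p' E) ->
  forall E, measurable E -> E `<=` D -> p E <= p' E.
Proof.
move=> mS pS nS pn E mE ED.
have mES : measurable (E `&` S) by exact: measurableI.
have mED : measurable (E `\` S) by exact: measurableD.
have ESD : E `&` S `<=` D by move=> x [/ED].
have pE : p E = p (E `&` S).
  rewrite (measureDI p mE mS) (@subset_measure0 _ _ _ p _ (~` S)) ?add0e//.
  exact: measurableC.
have nE : n (E `&` S) = 0 by exact: (subset_measure0 mES mS).
have := pn _ mES ESD; rewrite nE add0e -pE => pE'.
apply: (@le_trans _ _ (p' (E `&` S))); first by rewrite -pE' leeDl.
by apply: le_measure; rewrite ?inE//; exact: subIsetl.
Qed.

(** The balance is written with sums to avoid differences of infinite values. It is symmetric under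
    exchanging the two pairs and under exchanging the parts within both pairs, so [singular_part_le]
    gives all four inequalities. *)
Lemma jordan_unique (p n p' n' : {measure set T -> \bar R}) (S S' D : set T) :
  measurable S -> p (~` S) = 0 -> n S = 0 ->
  measurable S' -> p' (~` S') = 0 -> n' S' = 0 ->
  (forall E, measurable E -> E `<=` D -> p E + n' E = n E + p' E) ->
  forall E, measurable E -> E `<=` D -> p E = p' E /\ n E = n' E.
Proof.
move=> mS pS nS mS' pS' nS' pn E mE ED.
have np F : measurable F -> F `<=` D -> n F + p' F = p F + n' F.
  by move=> mF FD; rewrite pn.
have pn' F : measurable F -> F `<=` D -> p' F + n F = n' F + p F.
  by move=> mF FD; rewrite addeC -pn// addeC.
have np' F : measurable F -> F `<=` D -> n' F + p F = p' F + n F.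
  by move=> mF FD; rewrite pn'.
have CK (m : {measure set T -> \bar R}) X : m X = 0 -> m (~` ~` X) = 0.
  by rewrite setCK.
split; apply/eqP; rewrite eq_le.
- rewrite (singular_part_le mS pS nS pn mE ED).
  by rewrite (singular_part_le mS' pS' nS' pn' mE ED).
- rewrite (singular_part_le (measurableC mS) (CK _ _ nS) pS np mE ED).
  by rewrite (singular_part_le (measurableC mS') (CK _ _ nS') pS' np' mE ED).
Qed.

End jordan.

(** * Behaviour of touching sets, tubes and support measures under dilation *)

Section dilation.
Context {R : realType} {d : nat}.
Notation V := 'rV[R]_d.
Implicit Types (A : set V) (C : set (V * V)).

(** Dilating a set moves the foot points and keeps the unit normals. *)
Definition dil_fst (c : R) (p : V * V) : V * V := (c *: p.1, p.2).

Lemma measurable_dil_fst c : measurable_fun setT (dil_fst c).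
Proof.
apply: measurable_fun_pair; last exact: measurable_snd.
exact: (measurableT_comp (rV_measurable_scale c) measurable_fst).
Qed.

Lemma continuous_dil_fst c : continuous (dil_fst c).
Proof.
move=> p; have cp : c *: q.1 @[q --> p] --> c *: p.1 by apply: cvgZl_tmp; exact: cvg_fst.
exact: (cvg_pair cp cvg_snd).
Qed.

Lemma dil_fstK c : c != 0 -> cancel (dil_fst c) (dil_fst c^-1).
Proof. by move=> c0 [x u]; rewrite /dil_fst/= scalerA mulVf// scale1r. Qed.

Lemma preimage_dil_fst c C : c != 0 -> dil_fst c^-1 @^-1` C = dil_fst c @` C.
Proof.
move=> c0; apply/seteqP; split=> [p Cp|_ [p Cp <-]].
  exists (dil_fst c^-1 p) => //.
  by rewrite -[c in dil_fst c _]invrK dil_fstK// invr_eq0.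
by rewrite /preimage/= dil_fstK.
Qed.

Variables (r : R) (r0 : 0 < r).

Lemma touching_dilation A s x u :
  touching [set r *: x | x in A] (r * s) (r *: x, u) <-> touching A s (x, u).
Proof.
have E a : enorm (r *: x + (r * s) *: u - r *: a) = r * enorm (x + s *: u - a).
  by rewrite -scalerA -scalerDr -scalerBr enormZ gtr0_norm.
split=> -[/= Ax u1 sA]; split=> //=.
- case: Ax => y Ay /(congr1 (fun z => r^-1 *: z)).
  by rewrite !scalerA mulVf ?gt_eqF// !scale1r => <-.
- by move=> a Aa; rewrite -(ler_pM2l r0) -E; apply: sA; exists a.
- by exists x.
- by move=> _ [a Aa <-]; rewrite E ler_pM2l//; exact: sA.
Qed.

Lemma touching_preimage A s :
  touching [set r *: x | x in A] (r * s) = dil_fst r^-1 @^-1` touching A s.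
Proof.
apply/seteqP; split=> -[x u]; rewrite /preimage/= /dil_fst/= -(touching_dilation A);
  by rewrite scalerA divff ?gt_eqF// scale1r.
Qed.

Lemma tube_dilation C a b : tube (dil_fst r^-1 @^-1` C) (r * a) (r * b) =
  [set r *: y | y in tube C a b].
Proof.
rewrite preimage_dil_fst ?gt_eqF//; apply/seteqP; split.
  move=> y [[q t] [/= [[x u] Cxu <-]]]; rewrite in_itv/= => /andP[at_ tb] <-.
  exists (x + (r^-1 * t) *: u); last first.
    by rewrite scalerDr scalerA mulVKf ?gt_eqF.
  exists ((x, u), r^-1 * t) => //; split=> //=.
  by rewrite in_itv/= ler_pdivlMl// ler_pdivrMl// at_.
move=> y [z [[[x u] t] [/= Cxu]]]; rewrite in_itv/= => /andP[at_ tb] <- <-.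
exists ((r *: x, u), r * t); last by rewrite /= scalerDr scalerA.
by split=> /=; [exists (x, u)|rewrite in_itv/= !ler_pM2l// at_].
Qed.

Variables (A : set V) (A0 : A !=set0) (cA : compact A).
Variables (mu muR : 'I_d -> signed_measure R (V * V)%type).
Let rA := [set r *: x | x in A].
Hypothesis mu_support : is_support_measures A mu.
Hypothesis muR_support : is_support_measures rA muR.

Let rA0 : rA !=set0. Proof. by case: A0 => x Ax; exists (r *: x), x. Qed.

Let crA : compact rA.
Proof.
have cr : continuous (fun x : V => r *: x).
  exact: scaler_continuous.
exact: (continuous_compact (continuous_subspaceT cr) cA).
Qed.

Lemma signed_mass_dilation i s C : 0 < s ->
  measurable C -> compact C -> C `<=` touching A s ->
  signed_mass muR i (dil_fst r^-1 @^-1` C) = r ^+ i * signed_mass mu i C.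
Proof.
move=> s0 mC cC Cs; set C' := _ @^-1` C.
have rs0 : 0 < r * s by exact: mulr_gt0.
have mC' : measurable C'.
  by rewrite -[X in measurable X]setTI; exact: measurable_dil_fst.
have cC' : compact C'.
  rewrite /C' preimage_dil_fst ?gt_eqF//.
  exact: (continuous_compact (continuous_subspaceT (@continuous_dil_fst r)) cC).
have Cs' : C' `<=` touching rA (r * s).
  by rewrite touching_preimage => p; exact: Cs.
(* [g j] is the coefficient of b^(d-j) - (s/2)^(d-j) in the difference of the two Steiner formulas;
   its vanishing means r^(d-j) mu_j(rA; C') = r^d mu_j(A; C). *)
pose g (j : 'I_d) := omega (d - j) / (d - j)%:R *
  (r ^+ (d - j) * signed_mass muR j C' - r ^+ d * signed_mass mu j C) : R.
suff /(_ i)/eqP : forall j, g j = 0.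
  rewrite /g mulf_eq0 mulf_eq0 invr_eq0 (negbTE (omega_neq0 _)) ?subn_gt0//=.
  rewrite pnatr_eq0 subn_eq0 leqNgt ltn_ord/= subr_eq0.
  have -> : r ^+ d = r ^+ (d - i) * r ^+ i.
    by rewrite -exprD subnK// ltnW.
  rewrite -mulrA => /eqP.
  by move/mulfI; apply; rewrite expf_neq0// gt_eqF.
(* The inner radius is fixed at s/2, while the outer radius b ranges over the interval from s/2 to
   s. *)
have ss : s / 2 < s by rewrite ltr_pdivrMr// ltr_pMr// ltr1n.
apply: (sum_pow_eq0 ss) => b ab bs.
have a0 : 0 < s / 2 by rewrite divr_gt0.
have ra0 : 0 < r * (s / 2) by exact: mulr_gt0.
have rab : r * (s / 2) < r * b by rewrite ltr_pM2l.
have rbs : r * b < r * s by rewrite ltr_pM2l.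
have clK : closed (tube C (s / 2) b).
  apply: (compact_closed (@norm_hausdorff _ _)).
  have cCab : compact (C `*` `[s / 2, b]).
    exact: (compact_setX cC (@segment_compact R _ _)).
  exact: (continuous_compact (continuous_subspaceT (@rV_shift_continuous R d)) cCab).
have := lebesgue_tube rA0 crA muR_support ra0 rab rbs mC' cC' Cs'.
rewrite tube_dilation (lebesgue_rV_dilation r0 (rV_borel_closed clK)).
rewrite (lebesgue_tube A0 cA mu_support a0 ab bs mC cC Cs) -EFinM => -[].
move=> /eqP; rewrite eq_sym -subr_eq0 mulr_sumr -sumrB => /eqP E.
rewrite -[RHS]E; apply: eq_bigr => j _; rewrite /g !exprMn -mulrBr.
ring.
Qed.

(** [signed_mass_dilation] controls only differences of the two parts on compact sets. Uniqueness of
    finite measures on a generating class stable under intersection extends the balance to Borel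
    sets; [jordan_unique] then separates the parts. *)
Lemma pos_neg_part_dilation (i : 'I_d) s C : 0 < s -> measurable C -> C `<=` touching A s ->
  ((r ^+ i)%:E * pos_part (mu i) C = pos_part (muR i) (dil_fst r^-1 @^-1` C) /\
   (r ^+ i)%:E * neg_part (mu i) C = neg_part (muR i) (dil_fst r^-1 @^-1` C))%E.
Proof.
move=> s0 mC Cs.
have rs0 : 0 < r * s by exact: mulr_gt0.
pose ri : {nonneg R} := NngNum (exprn_ge0 i (ltW r0)).
have mdr := @measurable_dil_fst r^-1.
pose p : {measure set (V * V) -> \bar R} := scaled_measure ri (pos_part (mu i)).
pose n : {measure set (V * V) -> \bar R} := scaled_measure ri (neg_part (mu i)).
pose p' : {measure set (V * V) -> \bar R} := image_measure (pos_part (muR i)) mdr.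
pose n' : {measure set (V * V) -> \bar R} := image_measure (neg_part (muR i)) mdr.
have [S [mS pS nS]] := mutually_singular (mu i).
have [S' [mS' pS' nS']] := mutually_singular (muR i).
(* [S'] lives on the side of rA; its pullback is the set separating [p'] from [n']. *)
have SK : dil_fst r^-1 @^-1` (dil_fst r @^-1` S') = S'.
  apply/seteqP; split=> q; rewrite /preimage/= -{1}[r]invrK dil_fstK//;
    by rewrite invr_eq0 gt_eqF.
have mT := measurable_touching A0 cA s.
have fin_meas E : measurable E -> E `<=` touching A s ->
    [/\ (p E < +oo)%E, (n E < +oo)%E, (p' E < +oo)%E & (n' E < +oo)%E].
  move=> mE Es; have [pE nE] := signed_mass_fin A0 cA mu_support i s0 mE Es.
  have mE' : measurable (dil_fst r^-1 @^-1` E).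
    by rewrite -[X in measurable X]setTI; exact: measurable_dil_fst.
  have Es' : dil_fst r^-1 @^-1` E `<=` touching rA (r * s).
    by rewrite touching_preimage => q; exact: Es.
  have [pE' nE'] := signed_mass_fin rA0 crA muR_support i rs0 mE' Es'.
  by split=> //; rewrite /p /n /= /mscale/= lte_mul_pinfty// lee_fin exprn_ge0// ltW.
have balance E : measurable E -> E `<=` touching A s -> (p E + n' E = n E + p' E)%E.
  move=> mE Es; rewrite -(setIidl Es).
  (* Restriction to [touching A s] makes both sums finite and cuts closed rectangles down to compact
     sets, where [signed_mass_dilation] applies. *)
  pose m1 : {measure set (V * V) -> \bar R} := mrestr (measure_add p n') mT.
  pose m2 : {measure set (V * V) -> \bar R} := mrestr (measure_add n p') mT.
  have m1E X : (m1 X = p (X `&` touching A s) + n' (X `&` touching A s))%E.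
    exact: measure_addE.
  have m2E X : (m2 X = n (X `&` touching A s) + p' (X `&` touching A s))%E.
    exact: measure_addE.
  suff : m1 E = m2 E by rewrite m1E m2E.
  apply: (measure_unique [set K `*` L | K in @closed V & L in @closed V]
    (fun=> setT)) => //.
  - exact: rV_prod_gen_closed.
  - move=> _ _ [K1 cK1 [L1 cL1 <-]] [K2 cK2 [L2 cL2 <-]].
    rewrite -setXI; exists (K1 `&` K2); first exact: closedI.
    by exists (L1 `&` L2) => //; exact: closedI.
  - by move=> _; exists setT; [exact: closedT|exists setT; [exact: closedT|rewrite setXTT]].
  - by rewrite bigcup_const.
  - move=> _ [K cK [L cL <-]]; rewrite m1E m2E.
    set F := _ `&` _.
    have Fs : F `<=` touching A s by exact: subIsetr.
    have mF : measurable F.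
      by apply: measurableI => //; apply: measurableX; exact: rV_borel_closed.
    have cF : compact F.
      rewrite /F setIC; apply: compact_closedI; first exact: compact_touching.
      rewrite (_ : K `*` L = fst @^-1` K `&` snd @^-1` L)//.
      by apply: closedI; apply: preimage_closed => // q _; [exact: cvg_fst|exact: cvg_snd].
    have [pF nF pF' nF'] := fin_meas _ mF Fs.
    have [qF oF] := signed_mass_fin A0 cA mu_support i s0 mF Fs.
    have := signed_mass_dilation i s0 mF cF Fs.
    have pE : fine (p F) = r ^+ i * fine (pos_part (mu i) F).
      by rewrite /p /= /mscale/= fineM// ge0_fin_numE.
    have nE : fine (n F) = r ^+ i * fine (neg_part (mu i) F).
      by rewrite /n /= /mscale/= fineM// ge0_fin_numE.
    rewrite /signed_mass mulrBr -pE -nE -/(p' F) -/(n' F) => h.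
    rewrite -[p F]fineK ?ge0_fin_numE// -[n F]fineK ?ge0_fin_numE//.
    rewrite -[p' F]fineK ?ge0_fin_numE// -[n' F]fineK ?ge0_fin_numE//.
    by rewrite -!EFinD; congr EFin; move: h; rewrite /p' /n' /=; lra.
  - move=> _; rewrite m1E setTI.
    by have [? _ _ ?] := fin_meas _ mT (@subset_refl _ _); exact: lte_add_pinfty.
have pS0 : p (~` S) = 0%E by rewrite /p /= /mscale/= pS mule0.
have nS0 : n S = 0%E by rewrite /n /= /mscale/= nS mule0.
have mS'' : measurable (dil_fst r @^-1` S').
  by rewrite -[X in measurable X]setTI; exact: measurable_dil_fst.
have pS0' : p' (~` (dil_fst r @^-1` S')) = 0%E.
  transitivity (pos_part (muR i) (~` (dil_fst r^-1 @^-1` (dil_fst r @^-1` S')))) => //.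
  by rewrite SK.
have nS0' : n' (dil_fst r @^-1` S') = 0%E.
  transitivity (neg_part (muR i) (dil_fst r^-1 @^-1` (dil_fst r @^-1` S'))) => //.
  by rewrite SK.
exact: (jordan_unique mS pS0 nS0 mS'' pS0' nS0' balance mC Cs).
Qed.

End dilation.

(** * The sets where the local reach exceeds t, and the scaling of beta *)

Section reach_sets.
Context {R : realType} {d : nat}.
Notation V := 'rV[R]_d.
Implicit Types A : set V.

Definition reach_gt A (t : R) : set (V * V) :=
  [set p | normal_bundle A p /\ (t%:E < local_reach A p.1 p.2)%E].

Lemma reach_gt_touching A t : 0 < t -> reach_gt A t `<=` touching A t.
Proof.
move=> t0 p /(normal_bundleE _ _ (ltW t0))[s ts].
exact: (touching_le (ltW t0) (lt_trans t0 ts) (ltW ts)).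
Qed.

(** By [normal_bundleE] the condition asks for a touching ball of some radius above t; smaller balls
    touch as well, so the countably many radii t + 1/(n+1) suffice. *)
Lemma measurable_reach_gt A t : A !=set0 -> compact A -> 0 <= t ->
  measurable (reach_gt A t).
Proof.
move=> A0 cA t0.
rewrite (_ : reach_gt A t = \bigcup_n touching A (t + n.+1%:R^-1)); last first.
  apply/seteqP; split=> p.
    move=> /(normal_bundleE _ _ t0)[s ts sp].
    have [k tks] := ltr_add_invr ts.
    exists k => //; apply: (touching_le _ _ (ltW tks) sp); last exact: le_lt_trans ts.
    by rewrite addr_ge0// invr_ge0.
  move=> [n _ tp]; apply/(normal_bundleE _ _ t0).
  by exists (t + n.+1%:R^-1) => //; rewrite ltrDl invr_gt0.
by apply: bigcupT_measurable => n; exact: measurable_touching.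
Qed.

Lemma reach_gt_dilation A r t : 0 < r -> 0 <= t ->
  reach_gt [set r *: x | x in A] (r * t) = dil_fst r^-1 @^-1` reach_gt A t.
Proof.
move=> r0 t0; have rt0 : 0 <= r * t by rewrite mulr_ge0// ltW.
apply/seteqP; split=> p.
  move=> /(normal_bundleE _ _ rt0)[s ts sp]; apply/(normal_bundleE _ _ t0).
  exists (r^-1 * s); first by rewrite ltr_pdivlMl.
  by move: sp; rewrite -[s in touching _ s](mulVKf (lt0r_neq0 r0)) touching_preimage.
move=> /(normal_bundleE _ _ t0)[s ts sp]; apply/(normal_bundleE _ _ rt0).
by exists (r * s); rewrite ?ltr_pM2l// touching_preimage.
Qed.

(** Turns [beta] and [beta_var] into masses of a single measurable set. *)
Lemma integral_reach_gt A (m : {measure set (V * V) -> \bar R}) t :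
  A !=set0 -> compact A -> 0 <= t ->
  (\int[m]_(p in normal_bundle A) ((t%:E < local_reach A p.1 p.2)%E%:R)%:E
   = m (reach_gt A t))%E.
Proof.
move=> A0 cA t0.
rewrite (@integral_indic_sub R _ _ _ _ (reach_gt A t) _ 1) ?mul1e//.
- exact: measurable_reach_gt.
- by move=> p [].
- move=> p Np; rewrite mul1r indicE; congr ((nat_of_bool _)%:R%:E).
  by apply/idP/idP => [tp|]; rewrite inE// => -[].
Qed.

Variables (A : set V) (A0 : A !=set0) (cA : compact A) (r : R) (r0 : 0 < r).
Variables (mu muR : 'I_d -> signed_measure R (V * V)%type).
Let rA := [set r *: x | x in A].
Hypothesis mu_support : is_support_measures A mu.
Hypothesis muR_support : is_support_measures rA muR.
Variable i : 'I_d.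

Let rA0 : rA !=set0. Proof. by case: A0 => x Ax; exists (r *: x), x. Qed.

Let crA : compact rA.
Proof.
have cr : continuous (fun x : V => r *: x) by exact: scaler_continuous.
exact: (continuous_compact (continuous_subspaceT cr) cA).
Qed.

Lemma beta_dilation t : 0 < t ->
  (beta rA muR i (r * t) = (r ^+ i)%:E * beta A mu i t)%E.
Proof.
move=> t0; have rt0 : 0 < r * t by exact: mulr_gt0.
have mE := measurable_reach_gt A0 cA (ltW t0).
have [pE nE] := pos_neg_part_dilation r0 A0 cA mu_support muR_support i t0 mE
  (reach_gt_touching t0).
have [pf nf] := signed_mass_fin A0 cA mu_support i t0 mE (reach_gt_touching t0).
rewrite /beta /signed_integral.
rewrite (integral_reach_gt (pos_part (muR i)) rA0 crA (ltW rt0)).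
rewrite (integral_reach_gt (neg_part (muR i)) rA0 crA (ltW rt0)).
rewrite (integral_reach_gt (pos_part (mu i)) A0 cA (ltW t0)).
rewrite (integral_reach_gt (neg_part (mu i)) A0 cA (ltW t0)).
rewrite reach_gt_dilation ?ltW//.
(* Distributivity over an extended difference must exclude infinite minus infinite;
   [signed_mass_fin] provides finiteness. *)
rewrite muleBr//; last by rewrite fin_num_adde_defr// ge0_fin_numE.
by congr (_ - _)%E; apply/esym.
Qed.

Lemma beta_var_dilation t : 0 < t ->
  (beta_var rA muR i (r * t) = (r ^+ i)%:E * beta_var A mu i t)%E.
Proof.
move=> t0; have rt0 : 0 < r * t by exact: mulr_gt0.
have mE := measurable_reach_gt A0 cA (ltW t0).
have [pE nE] := pos_neg_part_dilation r0 A0 cA mu_support muR_support i t0 mE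
  (reach_gt_touching t0).
rewrite /beta_var (integral_reach_gt _ rA0 crA (ltW rt0)).
rewrite (integral_reach_gt _ A0 cA (ltW t0)).
rewrite reach_gt_dilation ?ltW// !total_variationE ge0_muleDr//.
by congr (_ + _)%E; apply/esym.
Qed.

End reach_sets.

Theorem proposition4p11 (R : realType) (d : nat) (d_ge2 : (2 <= d)%N)
    (A : set 'rV[R]_d) (A_neq0 : A !=set0) (A_compact : compact A)
    (r : R) (r_gt0 : 0 < r)
    (mu muR : 'I_d -> signed_measure R ('rV[R]_d * 'rV[R]_d)%type)
    (mu_support : is_support_measures A mu)
    (muR_support : is_support_measures [set r *: x | x in A] muR)
    (i : 'I_d) :
  let rA := [set r *: x | x in A] in
  [/\ upper_exponent rA muR i = upper_exponent A mu i
    , lower_exponent rA muR i = lower_exponent A mu i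
    , forall q : R,
        upper_content rA muR i q = ((r `^ q)%:E * upper_content A mu i q)%E
        /\ lower_content rA muR i q = ((r `^ q)%:E * lower_content A mu i q)%E
    & forall q : R,
        upper_content_var rA muR i q
          = ((r `^ q)%:E * upper_content_var A mu i q)%E
        /\ lower_content_var rA muR i q
          = ((r `^ q)%:E * lower_content_var A mu i q)%E ].
Proof.
move=> rA.
(* The substitution t -> r t rests on (r t)^(q-i) r^i = r^q t^(q-i). *)
have powE (q t : R) (x y : \bar R) : 0 < t -> y = ((r ^+ i)%:E * x)%E ->
    (((r * t) `^ (q - i%:R))%:E * y = (r `^ q)%:E * ((t `^ (q - i%:R))%:E * x))%E.
  move=> t0 ->; rewrite powRM ?ltW// !muleA -!EFinM; congr (_%:E * _)%E.
  rewrite -powR_mulrn ?ltW// mulrAC -powRD ?subrK//.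
  by rewrite (gt_eqF r_gt0) implybT.
have rq0 (q : R) : 0 < r `^ q by exact: powR_gt0.
have content q : upper_content rA muR i q = ((r `^ q)%:E * upper_content A mu i q)%E
    /\ lower_content rA muR i q = ((r `^ q)%:E * lower_content A mu i q)%E.
  split.
    by apply: (limf_esup_scale r_gt0) => // t t0; apply: powE => //; exact: beta_dilation.
  by apply: (limf_einf_scale r_gt0) => // t t0; apply: powE => //; exact: beta_dilation.
have content_var q :
    upper_content_var rA muR i q = ((r `^ q)%:E * upper_content_var A mu i q)%E
    /\ lower_content_var rA muR i q = ((r `^ q)%:E * lower_content_var A mu i q)%E.
  split.
    apply: (limf_esup_scale r_gt0) => // t t0; apply: powE => //.
    exact: beta_var_dilation.
  by apply: (limf_einf_scale r_gt0) => // t t0; apply: powE => //; exact: beta_var_dilation.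
(* Since r^q > 0, the contents of A and rA vanish for the same q, so the exponents are infima of
   equal sets. *)
have eq0 (q : R) (x y : \bar R) : y = ((r `^ q)%:E * x)%E -> (y = 0%E) = (x = 0%E).
  move=> ->; apply/propext; split=> [/eqP|->]; last exact: mule0.
  by rewrite mule_eq0 eqe gt_eqF//= => /eqP.
have upperE : [set q | upper_content_var rA muR i q = 0%E] =
    [set q | upper_content_var A mu i q = 0%E].
  by apply/funext => q; have [h _] := content_var q; exact: (eq0 q _ _ h).
have lowerE : [set q | lower_content_var rA muR i q = 0%E] =
    [set q | lower_content_var A mu i q = 0%E].
  by apply/funext => q; have [_ h] := content_var q; exact: (eq0 q _ _ h).
split.
- exact: (congr1 (fun S : set R => ereal_inf [set q%:E | q in S]) upperE).
- exact: (congr1 (fun S : set R => ereal_inf [set q%:E | q in S]) lowerE).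
- exact: content.
- exact: content_var.
Qed.
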